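(* Let $\Omega$ be an open subset of $\mathbb{C}$ and let $k:\Omega^2\to\mathbb{C}$ be a positive definite kernel on $\Omega$. If $k$ is sesquiholomorphic on an open set $\mathcal{U}\subseteq\Omega^2$ containing the diagonal $\mathcal{D}(\Omega^2)=\{(x,x):x\in\Omega\}$, then $k$ is a holomorphic reproducing kernel (holomorphic positive definite kernel) in $\Omega$, i.e. $k$ is sesquiholomorphic on $\Omega^2$.
   Context: A function $k:\Omega\times\Omega\to\mathbb{C}$ is a positive definite kernel on a nonempty set $\Omega$ if, for every $n\in\mathbb{N}$ and all finite collections $\{x_j\}_{j=1}^n\subset\Omega$ and $\{\xi_j\}_{j=1}^n\subset\mathbb{C}$, one has $\sum_{i,j=1}^n k(x_i,x_j)\,\xi_i\,\overline{\xi_j}\ge 0$. For an open set $\mathcal{U}\subset\mathbb{C}^2$ let $\mathcal{U}^*=\{(x,y)\in\mathbb{C}^2:(x,\overline{y})\in\mathcal{U}\}$. A function $k$ is sesquiholomorphic in $\mathcal{U}$ if there is a separately holomorphic function $g:\mathcal{U}^*\to\mathbb{C}$ (holomorphic in each variable separately) with $k(u,v)=g(u,\overline{v})$ for all $(u,v)\in\mathcal{U}$; i.e. $k(u,v)$ is separately holomorphic in $u$ and anti-holomorphic in $v$. A positive definite kernel $k$ on an open set $\Omega\subset\mathbb{C}$ is called a holomorphic positive definite kernel (or holomorphic reproducing kernel) in $\Omega$ if $k$ is sesquiholomorphic on $\Omega^2$. *)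

(* Defs.v *)
From Stdlib Require Import Reals.
From Coquelicot Require Import Coquelicot.
Open Scope R_scope.

Definition Cnonneg (z : C) : Prop := 0 <= Re z /\ Im z = 0.

(* A kernel on Omega is a total function on C * C; its values outside
   Omega * Omega play no role. The points x 1, ..., x n may repeat. *)
Definition positive_definite_kernel (Omega : C -> Prop) (k : C * C -> C) : Prop :=
  (exists w : C, Omega w) /\
  forall (n : nat) (x xi : nat -> C),
    (forall j : nat, (1 <= j <= n)%nat -> Omega (x j)) ->
    Cnonneg (sum_n_m (G := C_AbelianMonoid)
      (fun i => sum_n_m (G := C_AbelianMonoid)
        (fun j => (k (x i, x j) * xi i * Cconj (xi j))%C) 1 n) 1 n).

(* Complex differentiability at every point of D. This is holomorphy only for
   open D, and then it does not depend on the values of f outside D. *)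
Definition holomorphic_on (D : C -> Prop) (f : C -> C) : Prop :=
  forall z : C, D z -> ex_derive (K := C_AbsRing) (V := C_NormedModule) f z.

Definition separately_holomorphic_on (V : C * C -> Prop) (g : C * C -> C) : Prop :=
  (forall y : C, holomorphic_on (fun x => V (x, y)) (fun x => g (x, y))) /\
  (forall x : C, holomorphic_on (fun y => V (x, y)) (fun y => g (x, y))).

Definition conj_snd (U : C * C -> Prop) : C * C -> Prop :=
  fun p => U (fst p, Cconj (snd p)).

(* To be used for open U, so that conj_snd U and its slices are open. *)
Definition sesquiholomorphic_on (U : C * C -> Prop) (k : C * C -> C) : Prop :=
  exists g : C * C -> C,
    separately_holomorphic_on (conj_snd U) g /\
    forall u v : C, U (u, v) -> k (u, v) = g (u, Cconj v).

Definition square (Omega : C -> Prop) : C * C -> Prop :=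
  fun p => Omega (fst p) /\ Omega (snd p).

Definition holomorphic_positive_definite_kernel
    (Omega : C -> Prop) (k : C * C -> C) : Prop :=
  open Omega /\
  positive_definite_kernel Omega k /\
  sesquiholomorphic_on (square Omega) k.

(* Main.v *)
From mathcomp Require all_boot all_order all_algebra lra.
From mathcomp Require boolp classical_sets reals ereal topology normedtype.
From mathcomp Require sequences measure lebesgue_measure measurable_realfun.
From mathcomp Require Rstruct.
Require Import Defs.
From Stdlib Require Import Reals Lra Lia List Arith Factorial ClassicalEpsilon.

(** A positive definite kernel is Hermitian, so the claim reduces to this: for
    every [w] in [Omega], the section [f = k(., w)] is complex differentiable at
    every [z0] in [Omega].  Around [z0] the hypothesis provides a square on which
    the sections [k(., v)] are holomorphic, but only for [v] in that same square,
    and without Hartogs' theorem separate holomorphy yields no local bound for [k].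

    The section [f] is recovered by interpolation.  Fix nodes [t_0, ..., t_N] on a
    short segment [[z0, z0 + eta]] and let [P_N] be the Newton interpolation
    operator, so that [P_N f (y)] is a combination of the values [f (t_j)] whose
    coefficients do not depend on [f].  In the reproducing kernel space [f (y)] is
    the inner product of two kernel vectors, and the Cauchy-Schwarz inequality
    bounds the square of any combination [sum_j c_j k(p_j, w)] by a constant
    times the product of [sum_j |c_j|] and the largest of the values
    [|sum_j c_j k(p_j, p_i)|] ([kernel_node_control]).  Applied to interpolation
    errors, this controls the section at the arbitrary point [w] by the sections
    at the points [p_i], which lie in the square around [z0].  For the latter,
    Cauchy's formula on a square of half side [delta] shows that the error is at
    most a multiple of [M * (2 eta / (delta - eta)) ^ N], where [M] bounds the
    sections at the nodes on the contour ([newton_error]), while the coefficients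
    of [P_N] grow only exponentially as long as neighbouring nodes are at distance
    at least [eta / (2 (N + 1))] ([divided_diff_l1_norm], [newton_l1_norm_exp]).
    The decay wins if [eta] is small compared with [delta].

    The bound [M] has to be the same for all nodes and all [N].  The points [v] of
    the segment with [|k(u, v)| <= m] for all [u] on the contour form a closed set
    [F_m]; these sets increase with [m] and exhaust the segment.  By continuity of
    the Lebesgue measure some [F_m] fills more than half of the segment, and such
    a set contains well spaced nodes for every [N]
    ([exhaustion_spaced_points]).  The value of [m] is uncontrolled, but it only
    enters as a constant factor.

    So the polynomials [P_N f] converge to [f] uniformly near [z0], and a uniform
    limit of holomorphic functions is holomorphic ([Weierstrass]).  Holomorphy
    means pointwise complex differentiability here, without continuity of the
    derivative, so Cauchy's formula on rectangles rests on Goursat's theorem. *)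

(** * Spaced points in the members of an exhaustion of a segment *)

Module SpacedPoints.
Set Implicit Arguments.
Unset Strict Implicit.
Unset Printing Implicit Defensive.
Import all_boot all_order all_algebra.
Import boolp classical_sets reals ereal topology normedtype sequences measure lebesgue_measure measurable_realfun.
Import Rstruct lra.
Import Order.TTheory GRing.Theory Num.Theory numFieldNormedType.Exports.
Local Open Scope classical_set_scope.
Local Open Scope ring_scope.

Lemma lebesgue_measure_subU (R : realType) (A B C : set R) :
  measurable A -> measurable B -> measurable C -> A `<=` B `|` C ->
  (lebesgue_measure A <= lebesgue_measure B + lebesgue_measure C)%E.
Proof.
move=> mA mB mC sA; apply: (@le_trans _ _ (lebesgue_measure (B `|` C))).
  by apply: le_measure; rewrite ?inE//; apply: measurableU.
exact: measureU2.
Qed.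

(** Pick the leftmost point of the set up to [e], and skip a stretch of length [h]
    after it: this loses at most [h + e] of the measure, where [e] is the amount by
    which the measure exceeds what is needed. *)
Lemma spaced_points_of_measure (R : realType) (G : set R) (h : R) : 0 < h -> measurable G ->
  G `<=` `[0, 1] ->
  forall (n : nat) (a : R),
  ((n%:R * h)%:E < lebesgue_measure (G `&` `[a, +oo[))%E ->
  exists t : nat -> R,
    (forall i, (i <= n)%N -> G (t i) /\ a <= t i) /\
    (forall i, (i < n)%N -> t i + h <= t i.+1).
Proof.
move=> h0 mG G01; elim=> [|n IH] a.
  rewrite mul0r => mu0.
  have [x [Gx]] : (G `&` `[a, +oo[) !=set0.
    by apply/set0P/eqP => E; move: mu0; rewrite E measure0 ltxx.
  rewrite /= in_itv /= andbT => ax.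
  by exists (fun=> x); split.
move=> mua.
set A := G `&` `[a, +oo[ in mua *.
have mA : measurable A by apply: measurableI.
have A1 : (lebesgue_measure A <= 1)%E.
  have -> : 1%E = lebesgue_measure (`[0 : R, 1]%classic).
    by rewrite lebesgue_measure_itv /= lte_fin ltr01 oppr0 adde0.
  apply: le_measure; rewrite ?inE//.
  by move=> x [/G01].
have Afin : lebesgue_measure A \is a fin_num.
  by rewrite ge0_fin_numE// (le_lt_trans A1)// ltry.
have A0 : A !=set0.
  apply/set0P/eqP => E; move: mua; rewrite E measure0 lte_fin ltNge.
  by rewrite mulr_ge0// ltW.
have iA : has_inf A.
  split => //; exists a => x [_] /=.
  by rewrite in_itv /= andbT.
set e := fine (lebesgue_measure A) - n.+1%:R * h.
have e0 : 0 < e by rewrite subr_gt0 -lte_fin fineK.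
have [t0 At0 t0lt] := inf_adherent e0 iA.
have split_A : A `<=` `[inf A, t0 + h[ `|` (G `&` `[t0 + h, +oo[).
  move=> x Ax; have [xlt|xge] := ltP x (t0 + h).
    left; rewrite /= in_itv /= xlt andbT.
    by apply: ge_inf => //; case: iA.
  by right; split; [case: Ax|rewrite /= in_itv /= andbT].
have mI : measurable (`[inf A, t0 + h[ : set R) by exact: measurable_itv.
have mB : measurable (G `&` `[t0 + h, +oo[) by apply: measurableI.
have := lebesgue_measure_subU mA mI mB split_A.
have infA : inf A < t0 + h.
  apply: (@le_lt_trans _ _ t0); last by rewrite ltrDl.
  by apply: ge_inf => //; case: iA.
rewrite lebesgue_measure_itv /= lte_fin infA -EFinD => muA.
have : ((n%:R * h)%:E < lebesgue_measure (G `&` `[(t0 + h)%R, +oo[))%E.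
  have lt1 : (t0 + h - inf A < e + h)%R by move: t0lt; lra.
  rewrite ltNge; apply/negP => Hle.
  have := le_trans muA (leeD (lexx _) Hle).
  rewrite -EFinD -(fineK Afin) lee_fin.
  move: lt1; rewrite /e -natr1 mulrDl mul1r.
  by move: (fine _) => u; lra.
case/IH => t [tG tstep].
exists (fun i => if i is j.+1 then t j else t0); split.
  case=> [_|i]; first by case: At0 => ? /=; rewrite in_itv /= andbT.
  move=> /tG[? ti]; split=> //; apply: le_trans ti.
  case: At0 => _ /=; rewrite in_itv /= andbT => ?.
  by apply: (@le_trans _ _ t0) => //; rewrite lerDl ltW.
case=> [_|i /tstep//]; by case: (tG 0%N).
Qed.

(** Some [F m] has measure more than one half, by continuity of the measure along
    increasing unions, and [N] gaps of length [1 / (2 (N + 1))] use up less than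
    one half. *)
Lemma exhaustion_spaced_points (R : realType) (F : nat -> set R) :
  (forall m, closed (F m)) -> (forall m, F m `<=` F m.+1) ->
  (forall x : R, 0 <= x <= 1 -> exists m, F m x) ->
  exists m, forall N : nat, exists t : nat -> R,
    (forall i, (i <= N)%N -> F m (t i) /\ 0 <= t i <= 1) /\
    (forall i, (i < N)%N -> t i + (2 * N.+1%:R)^-1 <= t i.+1).
Proof.
move=> clF incF covF.
set G := fun m => F m `&` `[0, 1].
have mG m : measurable (G m).
  by apply: measurableI; [exact: closed_measurable|exact: measurable_itv].
have GE : \bigcup_m G m = `[0, 1]%classic.
  apply/seteqP; split=> [x [m _ []]//|x /= x01].
  have [m Fm] := covF x x01.
  by exists m.
have Gcvg : (lebesgue_measure \o G) x @[x --> \oo] --> (1%E : \bar R).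
  have -> : 1%E = lebesgue_measure (\bigcup_m G m).
    by rewrite GE lebesgue_measure_itv /= lte_fin ltr01 oppr0 adde0.
  apply: nondecreasing_cvg_mu => //; first by rewrite GE; exact: measurable_itv.
  apply: homo_leq => [A|B A C AB BC|n]; [exact: lexx|exact: le_trans AB BC|apply/subsetPset].
  by move=> x [/incF].
have [m mG2] : exists m, ((2^-1)%:E < lebesgue_measure (G m))%E.
  have : \forall m \near \oo, ((2^-1)%:E < (lebesgue_measure \o G) m)%E.
    apply: (Gcvg [set y | (2^-1)%:E < y]%E).
    apply: open_nbhs_nbhs; split; first exact: open_ereal_gt_ereal.
    by rewrite /= lte_fin; lra.
  by case=> m _ /(_ m (leqnn m)); exists m.
exists m => N.
have h0 : 0 < (2 * N.+1%:R)^-1 :> R by rewrite invr_gt0 mulr_gt0.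
have := @spaced_points_of_measure R (G m) _ h0 (mG m) _ N 0.
have -> : G m `&` `[0, +oo[ = G m.
  apply/seteqP; split=> [x []//|x Gx]; split=> //.
  by case: Gx => _ /=; rewrite !in_itv /= andbT => /andP[].
case=> [x []//||t [tG tstep]].
  apply: le_lt_trans mG2; rewrite lee_fin.
  rewrite invfM mulrC -mulrA ler_piMr ?invr_ge0//.
  by rewrite mulrC ler_pdivrMr ?ltr0n// mul1r ler_nat leqW.
by exists t; split=> // i /tG[[? ?] ?]; split.
Qed.

(** Free of topological vocabulary, so that it combines with the analysis over the
    standard real numbers below. *)
Lemma exhaustion_spaced_points_R (F : nat -> Rdefinitions.R -> Prop) :
  (forall m x, ~ F m x -> exists e, Rlt 0 e /\
     forall y, Rlt (Rabs (y - x)) e -> ~ F m y) ->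
  (forall m x, F m x -> F (S m) x) ->
  (forall x, Rle 0 x /\ Rle x 1 -> exists m, F m x) ->
  exists m, forall N : nat, exists t : nat -> Rdefinitions.R,
    (forall i, le i N -> F m (t i) /\ Rle 0 (t i) /\ Rle (t i) 1) /\
    (forall i, lt i N -> Rle (Rplus (t i) (Rinv (Rmult 2 (INR (S N))))) (t (S i))).
Proof.
move=> clF incF covF.
have [||x /andP[/RleP x0 /RleP x1]|m Fm] := @exhaustion_spaced_points Rdefinitions.R F.
- move=> m; rewrite -[F m]setCK; apply: open_closedC.
  rewrite openE => x /= /clF[e [/RltP e0 He]].
  exists e => //= y /=; rewrite /ball /= distrC => /RltP xy.
  exact: He.
- exact: incF.
- exact: covF.
exists m => N; have [t [tF ts]] := Fm N.
exists t; split=> i /ssrnat.leP iN.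
  by have [? /andP[/RleP ? /RleP ?]] := tF _ iN.
apply/RleP; have := ts _ iN.
by rewrite RplusE RinvE RmultE INRE.
Qed.

End SpacedPoints.

From Coquelicot Require Import Coquelicot.
Import ListNotations.
Local Open Scope C_scope.

(** * Complex continuity and differentiability *)

(** Epsilon-delta form for the modulus, which avoids choosing between the uniform
    structures that the complex numbers carry. *)
Definition ccontinuous (g : C -> C) (z : C) : Prop :=
  forall e, (0 < e)%R -> exists d, (0 < d)%R /\
    forall y, (Cmod (y - z) < d -> Cmod (g y - g z) < e)%R.

(** The error is compared with [e * Cmod (y - z)] instead of dividing by [y - z], so
    that [y = z] is not an exception. *)
Definition has_cderiv (g : C -> C) (z l : C) : Prop :=
  forall e, (0 < e)%R -> exists d, (0 < d)%R /\
    forall y, (Cmod (y - z) < d -> Cmod (g y - g z - l * (y - z)) <= e * Cmod (y - z))%R.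

Lemma is_derive_has_cderiv (g : C -> C) z l :
  is_derive (K := C_AbsRing) (V := C_NormedModule) g z l <-> has_cderiv g z l.
Proof.
  split.
  - intros [_ H] e He.
    destruct (H z (fun P HP => HP) (mkposreal e He)) as [d Hd].
    exists d; split; [apply cond_pos|]. intros y Hy.
    specialize (Hd y Hy). simpl in Hd.
    unfold minus, plus, opp, scal in Hd; simpl in Hd.
    unfold norm in Hd; simpl in Hd.
    replace (g y - g z - l * (y - z))%C with (g y + - g z + - mult (y + - z) l)%C; [exact Hd|].
    unfold mult; simpl. ring.
  - intros H; split.
    + apply is_linear_scal_l.
    + intros x Hx.
      apply (is_filter_lim_locally_unique (V := AbsRing_NormedModule C_AbsRing)) in Hx. subst x.
      intros e. destruct (H e (cond_pos e)) as [d [d0 Hd]].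
      exists (mkposreal _ d0). intros y Hy.
      specialize (Hd y Hy).
      replace (norm _) with (Cmod (g y - g z - l * (y - z))); [exact Hd|].
      unfold norm, minus, plus, opp, scal; simpl. unfold mult; simpl. f_equal. ring.
Qed.

Lemma ex_derive_has_cderiv (f : C -> C) z :
  ex_derive (K := C_AbsRing) (V := C_NormedModule) f z <-> exists l, has_cderiv f z l.
Proof.
  split; intros [l Hl]; exists l.
  - exact (proj1 (is_derive_has_cderiv f z l) Hl).
  - exact (proj2 (is_derive_has_cderiv f z l) Hl).
Qed.

Lemma has_cderiv_ccontinuous g z l : has_cderiv g z l -> ccontinuous g z.
Proof.
  intros H e He. destruct (H 1%R Rlt_0_1) as [d [d0 Hd]].
  assert (L0 := Cmod_ge_0 l).
  exists (Rmin d (e / (2 + Cmod l))). split.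
  { apply Rmin_pos; auto. apply Rdiv_lt_0_compat; lra. }
  intros y Hy.
  assert (H1 := Hd y (Rlt_le_trans _ _ _ Hy (Rmin_l _ _))).
  assert (H2 := Rlt_le_trans _ _ _ Hy (Rmin_r _ _)).
  replace (g y - g z) with ((g y - g z - l * (y - z)) + l * (y - z)) by ring.
  eapply Rle_lt_trans; [apply Cmod_triangle|]. rewrite Cmod_mult.
  assert (C0 := Cmod_ge_0 (y - z)).
  apply (Rmult_lt_compat_r (2 + Cmod l)) in H2; [|lra].
  unfold Rdiv in H2. rewrite Rmult_assoc, Rinv_l, Rmult_1_r in H2 by lra.
  nra.
Qed.

Lemma ccontinuous_const c z : ccontinuous (fun _ => c) z.
Proof.
  intros e He. exists 1%R. split; [lra|]. intros y _.
  replace (c - c) with (RtoC 0) by ring. rewrite Cmod_0. exact He.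
Qed.

Lemma ccontinuous_id z : ccontinuous (fun x => x) z.
Proof. intros e He. exists e. auto. Qed.

Lemma ccontinuous_plus f g z : ccontinuous f z -> ccontinuous g z -> ccontinuous (fun x => f x + g x) z.
Proof.
  intros Hf Hg e He.
  destruct (Hf (e / 2)%R ltac:(lra)) as [d1 [d10 Hd1]].
  destruct (Hg (e / 2)%R ltac:(lra)) as [d2 [d20 Hd2]].
  exists (Rmin d1 d2). split; [apply Rmin_pos; auto|]. intros y Hy.
  specialize (Hd1 y (Rlt_le_trans _ _ _ Hy (Rmin_l _ _))).
  specialize (Hd2 y (Rlt_le_trans _ _ _ Hy (Rmin_r _ _))).
  replace (f y + g y - (f z + g z)) with ((f y - f z) + (g y - g z)) by ring.
  eapply Rle_lt_trans; [apply Cmod_triangle|lra].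
Qed.

Lemma ccontinuous_mult f g z : ccontinuous f z -> ccontinuous g z -> ccontinuous (fun x => f x * g x) z.
Proof.
  intros Hf Hg e He.
  assert (F0 := Cmod_ge_0 (f z)). assert (G0 := Cmod_ge_0 (g z)).
  destruct (Hf (e / (2 * (Cmod (g z) + 1)))%R ltac:(apply Rdiv_lt_0_compat; lra)) as [d1 [d10 Hd1]].
  destruct (Hg (Rmin 1 (e / (2 * (Cmod (f z) + 1))))%R
    ltac:(apply Rmin_pos; [lra|apply Rdiv_lt_0_compat; lra])) as [d2 [d20 Hd2]].
  exists (Rmin d1 d2). split; [apply Rmin_pos; auto|]. intros y Hy.
  specialize (Hd1 y (Rlt_le_trans _ _ _ Hy (Rmin_l _ _))).
  specialize (Hd2 y (Rlt_le_trans _ _ _ Hy (Rmin_r _ _))).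
  assert (Hd3 := Rlt_le_trans _ _ _ Hd2 (Rmin_l _ _)).
  assert (Hd4 := Rlt_le_trans _ _ _ Hd2 (Rmin_r _ _)).
  replace (f y * g y - f z * g z) with ((f y - f z) * (g z + (g y - g z)) + f z * (g y - g z)) by ring.
  eapply Rle_lt_trans; [apply Cmod_triangle|]. rewrite !Cmod_mult.
  assert (T := Cmod_triangle (g z) (g y - g z)).
  assert (P := Cmod_ge_0 (f y - f z)). assert (Q := Cmod_ge_0 (g y - g z)).
  assert (H1 : (Cmod (f y - f z) * Cmod (g z + (g y - g z)) <= Cmod (f y - f z) * (Cmod (g z) + 1))%R)
    by (apply Rmult_le_compat_l; lra).
  assert (H2 : (Cmod (f y - f z) * (Cmod (g z) + 1) < e / 2)%R).
  { apply (Rmult_lt_compat_r (Cmod (g z) + 1)) in Hd1; [|lra].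
    replace (e / 2)%R with (e / (2 * (Cmod (g z) + 1)) * (Cmod (g z) + 1))%R by (field; lra). exact Hd1. }
  assert (H3 : ((Cmod (f z) + 1) * Cmod (g y - g z) <= e / 2)%R).
  { apply Rlt_le in Hd4. apply (Rmult_le_compat_l (Cmod (f z) + 1)) in Hd4; [|lra].
    replace (e / 2)%R with ((Cmod (f z) + 1) * (e / (2 * (Cmod (f z) + 1))))%R by (field; lra). exact Hd4. }
  nra.
Qed.

Lemma ccontinuous_inv (g : C -> C) z : g z <> 0 -> ccontinuous g z -> ccontinuous (fun x => / g x) z.
Proof.
  intros Hz Hg e He. assert (G0 := proj1 (Cmod_gt_0 _) Hz).
  destruct (Hg (Rmin (Cmod (g z) / 2) (e * Cmod (g z) ^ 2 / 2))%R) as [d [d0 Hd]].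
  { apply Rmin_pos; [lra|]. apply Rdiv_lt_0_compat; [|lra]. apply Rmult_lt_0_compat; auto. apply pow_lt; auto. }
  exists d. split; auto. intros y Hy. specialize (Hd y Hy).
  assert (Hd3 := Rlt_le_trans _ _ _ Hd (Rmin_l _ _)).
  assert (Hd4 := Rlt_le_trans _ _ _ Hd (Rmin_r _ _)).
  assert (T := Cmod_triangle (g y) (- (g y - g z))). rewrite Cmod_opp in T.
  replace (g y + - (g y - g z)) with (g z) in T by ring.
  assert (Y0 : (Cmod (g z) / 2 < Cmod (g y))%R) by lra.
  assert (Hy0 : g y <> 0) by (apply Cmod_gt_0; lra).
  replace (/ g y - / g z) with (- (g y - g z) * / (g y * g z)) by (field; auto).
  rewrite Cmod_mult, Cmod_opp, Cmod_inv, Cmod_mult by (apply Cmult_neq_0; auto).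
  apply Rmult_lt_reg_r with (Cmod (g y) * Cmod (g z))%R; [nra|].
  rewrite Rmult_assoc, Rinv_l by nra.
  assert (0 < e * Cmod (g z) * (Cmod (g y) - Cmod (g z) / 2))%R
    by (repeat apply Rmult_lt_0_compat; lra).
  simpl in Hd4. nra.
Qed.

Lemma has_cderiv_ext_loc f g z l d : (0 < d)%R ->
  (forall y, (Cmod (y - z) < d)%R -> f y = g y) -> has_cderiv f z l -> has_cderiv g z l.
Proof.
  intros Hd E H e He. destruct (H e He) as [d' [d0' Hd']].
  exists (Rmin d d'). split; [apply Rmin_pos; auto|]. intros y Hy.
  assert (Hy1 := Rlt_le_trans _ _ _ Hy (Rmin_l _ _)).
  rewrite <- !E.
  - apply Hd'. exact (Rlt_le_trans _ _ _ Hy (Rmin_r _ _)).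
  - replace (z - z) with (RtoC 0) by ring. rewrite Cmod_0. exact Hd.
  - exact Hy1.
Qed.

Lemma has_cderiv_ext f g z l : (forall y, f y = g y) -> has_cderiv f z l -> has_cderiv g z l.
Proof. intros E. apply (has_cderiv_ext_loc f g z l 1 Rlt_0_1). intros y _. apply E. Qed.

(** Caratheodory's form of differentiability: it reduces the algebra of derivatives
    to that of continuous functions. *)
Lemma has_cderiv_slope f z l : has_cderiv f z l <->
  exists s, s z = l /\ ccontinuous s z /\ forall y, f y = f z + s y * (y - z).
Proof.
  split.
  - intros H.
    exists (fun y => if excluded_middle_informative (y = z) then l else (f y - f z) / (y - z)).
    split; [|split].
    + destruct excluded_middle_informative; congruence.
    + intros e He. destruct (H (e / 2)%R ltac:(lra)) as [d [d0 Hd]]. exists d. split; auto.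
      intros y Hy. specialize (Hd y Hy).
      destruct (excluded_middle_informative (z = z)); [|congruence].
      destruct excluded_middle_informative as [E|E].
      * replace (l - l) with (RtoC 0) by ring. rewrite Cmod_0. exact He.
      * assert (E' : y - z <> 0) by (apply Cminus_eq_contra; exact E).
        assert (C0 := proj1 (Cmod_gt_0 _) E').
        replace ((f y - f z) / (y - z) - l) with ((f y - f z - l * (y - z)) / (y - z)) by (field; auto).
        rewrite Cmod_div by assumption.
        apply Rmult_lt_reg_r with (Cmod (y - z)); auto.
        unfold Rdiv. rewrite Rmult_assoc, Rinv_l by lra. nra.
    + intros y. destruct excluded_middle_informative as [E|E].
      * subst. ring.
      * field. apply Cminus_eq_contra; exact E.
  - intros (s & Hs & Hc & Hf) e He.
    destruct (Hc e He) as [d [d0 Hd]]. exists d. split; auto. intros y Hy.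
    specialize (Hd y Hy). rewrite Hf, Hs in *.
    replace (f z + s y * (y - z) - f z - l * (y - z)) with ((s y - l) * (y - z)) by ring.
    rewrite Cmod_mult. apply Rmult_le_compat_r; [apply Cmod_ge_0|lra].
Qed.

Lemma has_cderiv_const c z : has_cderiv (fun _ => c) z 0.
Proof.
  apply has_cderiv_slope. exists (fun _ => 0). repeat split; [apply ccontinuous_const|]. intros; ring.
Qed.

Lemma has_cderiv_id z : has_cderiv (fun x => x) z 1.
Proof.
  apply has_cderiv_slope. exists (fun _ => 1). repeat split; [apply ccontinuous_const|]. intros; ring.
Qed.

Lemma has_cderiv_plus f g z l m : has_cderiv f z l -> has_cderiv g z m -> has_cderiv (fun x => f x + g x) z (l + m).
Proof.
  rewrite !has_cderiv_slope. intros (s & Es & Cs & Hs) (t & Et & Ct & Ht).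
  exists (fun x => s x + t x). split; [congruence|]. split; [apply ccontinuous_plus; auto|].
  intros y. rewrite (Hs y), (Ht y). ring.
Qed.

Lemma has_cderiv_mult f g z l m : has_cderiv f z l -> has_cderiv g z m ->
  has_cderiv (fun x => f x * g x) z (l * g z + f z * m).
Proof.
  intros Hf Hg. assert (Cg := has_cderiv_ccontinuous _ _ _ Hg). revert Hf Hg.
  rewrite !has_cderiv_slope. intros (s & Es & Cs & Hs) (t & Et & Ct & Ht).
  exists (fun x => s x * g x + f z * t x). split; [congruence|].
  split; [apply ccontinuous_plus; apply ccontinuous_mult; auto; apply ccontinuous_const|].
  intros y. rewrite (Hs y), (Ht y). ring.
Qed.

Lemma has_cderiv_inv (g : C -> C) z m : g z <> 0 -> has_cderiv g z m -> exists l, has_cderiv (fun x => / g x) z l.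
Proof.
  intros H0 Hg. assert (Cg := has_cderiv_ccontinuous _ _ _ Hg). revert Hg.
  rewrite has_cderiv_slope. intros (t & Et & Ct & Ht).
  set (s := fun x => if excluded_middle_informative (g x = RtoC 0)
     then (/ g x - / g z) / (x - z) else - t x * / (g x * g z)).
  exists (s z). rewrite has_cderiv_slope. exists s. split; [reflexivity|]. split.
  - assert (Hc : ccontinuous (fun x => - t x * / (g x * g z)) z).
    { apply ccontinuous_mult.
      - intros e He. destruct (Ct e He) as [d [d0 Hd]]. exists d. split; auto. intros y Hy.
        replace (- t y - - t z) with (- (t y - t z)) by ring. rewrite Cmod_opp. auto.
      - apply (ccontinuous_inv (fun x => g x * g z)); [apply Cmult_neq_0; auto|].
        apply ccontinuous_mult; auto. apply ccontinuous_const. }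
    intros e He. destruct (Hc e He) as [d [d0 Hd]].
    destruct (Cg (Cmod (g z)) (proj1 (Cmod_gt_0 _) H0)) as [d' [d0' Hd']].
    exists (Rmin d d'). split; [apply Rmin_pos; auto|]. intros y Hy.
    specialize (Hd y (Rlt_le_trans _ _ _ Hy (Rmin_l _ _))).
    specialize (Hd' y (Rlt_le_trans _ _ _ Hy (Rmin_r _ _))).
    unfold s. destruct (excluded_middle_informative (g z = RtoC 0)); [tauto|].
    destruct (excluded_middle_informative (g y = RtoC 0)) as [E|E]; auto.
    rewrite E in Hd'. replace (0 - g z) with (- g z) in Hd' by ring. rewrite Cmod_opp in Hd'. lra.
  - intros y. destruct (excluded_middle_informative (y = z)) as [->|E]; [ring|].
    apply Cminus_eq_contra in E. unfold s.
    destruct (excluded_middle_informative (g y = RtoC 0)) as [E'|E'].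
    + generalize (/ g y) (/ g z). intros u v. field. exact E.
    + transitivity (/ g z - (g y - g z) * / (g y * g z)); [field; auto|].
      rewrite (Ht y). ring.
Qed.

Lemma has_cderiv_ex_mult f g z : (exists l, has_cderiv f z l) -> (exists l, has_cderiv g z l) ->
  exists l, has_cderiv (fun x => f x * g x) z l.
Proof. intros [l Hl] [m Hm]. eexists. apply has_cderiv_mult; eassumption. Qed.

Lemma has_cderiv_sub_const g z l c : has_cderiv g z l -> has_cderiv (fun x => g x - c) z l.
Proof.
  intros H. replace l with (l + 0) by ring.
  exact (has_cderiv_plus g (fun _ => - c) z l 0 H (has_cderiv_const (- c) z)).
Qed.

Lemma has_cderiv_inv_sub a z : z <> a -> exists l, has_cderiv (fun x => / (x - a)) z l.
Proof.
  intros H. apply (has_cderiv_inv (fun x => x - a) z 1).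
  - apply Cminus_eq_contra; auto.
  - apply has_cderiv_sub_const, has_cderiv_id.
Qed.

(** Conjugating both the argument and the value preserves holomorphy; this is how
    the statement for the first variable of a Hermitian kernel passes to the second. *)
Lemma has_cderiv_conj f z l : has_cderiv f (Cconj z) l ->
  has_cderiv (fun y => Cconj (f (Cconj y))) z (Cconj l).
Proof.
  intros H e He. destruct (H e He) as [d [d0 Hd]]. exists d. split; auto. intros y Hy.
  specialize (Hd (Cconj y)). rewrite <- Cminus_conj, Cmod_conj in Hd. specialize (Hd Hy).
  rewrite <- (Cmod_conj (_ - _)), !Cminus_conj, Cmult_conj, !Cconj_conj. exact Hd.
Qed.

(** * Integrals over the boundary of a rectangle *)

Definition is_CInt (f : R -> C) (a b : R) (l : C) : Prop :=
  is_RInt (V := C_R_NormedModule) f a b l.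

Definition CInt (f : R -> C) (a b : R) : C :=
  RInt (V := C_R_CompleteNormedModule) f a b.

Lemma norm_C_R (x : C) : norm (V := C_R_NormedModule) x = Cmod x.
Proof. symmetry. apply Cmod_norm. Qed.

Lemma is_CInt_unique f a b l : is_CInt f a b l -> CInt f a b = l.
Proof. apply (is_RInt_unique (V := C_R_CompleteNormedModule)). Qed.

Lemma is_CInt_iff f a b l : is_CInt f a b l <->
  (is_RInt (fun x => Re (f x)) a b (Re l) /\ is_RInt (fun x => Im (f x)) a b (Im l)).
Proof.
  split.
  - intros H; split.
    + apply (is_RInt_fct_extend_fst (U := R_NormedModule) (V := R_NormedModule) f a b l H).
    + apply (is_RInt_fct_extend_snd (U := R_NormedModule) (V := R_NormedModule) f a b l H).
  - intros [H1 H2]. destruct l as [re im].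
    exact (is_RInt_fct_extend_pair (U := R_NormedModule) (V := R_NormedModule) f a b re im H1 H2).
Qed.

Lemma is_CInt_plus f g a b l m :
  is_CInt f a b l -> is_CInt g a b m -> is_CInt (fun x => f x + g x) a b (l + m).
Proof. apply (is_RInt_plus (V := C_R_NormedModule)). Qed.

Lemma is_CInt_minus f g a b l m :
  is_CInt f a b l -> is_CInt g a b m -> is_CInt (fun x => f x - g x) a b (l - m).
Proof. apply (is_RInt_minus (V := C_R_NormedModule)). Qed.

Lemma is_CInt_scal (c : C) f a b l :
  is_CInt f a b l -> is_CInt (fun x => c * f x) a b (c * l).
Proof.
  rewrite !is_CInt_iff; intros [H1 H2]; split.
  - apply (is_RInt_minus (V := R_NormedModule) (fun x => Re c * Re (f x))%R (fun x => Im c * Im (f x))%R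
      a b (Re c * Re l)%R (Im c * Im l)%R);
    apply (is_RInt_scal (V := R_NormedModule)); assumption.
  - apply (is_RInt_plus (V := R_NormedModule) (fun x => Re c * Im (f x))%R (fun x => Im c * Re (f x))%R
      a b (Re c * Im l)%R (Im c * Re l)%R);
    apply (is_RInt_scal (V := R_NormedModule)); assumption.
Qed.

Lemma is_CInt_ext f g a b l : (forall x, f x = g x) ->
  is_CInt f a b l -> is_CInt g a b l.
Proof. intros H. apply (is_RInt_ext (V := C_R_NormedModule)). intros x _. apply H. Qed.

Lemma is_CInt_bound f a b l M : (a <= b)%R ->
  (forall x, a <= x <= b -> Cmod (f x) <= M)%R -> is_CInt f a b l ->
  (Cmod l <= (b - a) * M)%R.
Proof.
  intros ab H I. rewrite <- norm_C_R.
  apply (norm_RInt_le_const (V := C_R_NormedModule) f a b l M ab); [|exact I].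
  intros x Hx. rewrite norm_C_R. auto.
Qed.

Lemma ccontinuous_line (g : C -> C) (p : R -> C) (t : R) :
  (forall s, Cmod (p s - p t) <= Rabs (s - t))%R -> ccontinuous g (p t) ->
  continuous (U := C_R_NormedModule) (fun s => g (p s)) t.
Proof.
  intros Hp Hg. apply filterlim_locally. intros e.
  destruct (Hg e (cond_pos e)) as [d [d0 Hd]].
  exists (mkposreal d d0). intros s Hs.
  apply (C_NormedModule_mixin_compat1 (g (p t)) (g (p s)) e).
  apply Hd. eapply Rle_lt_trans; [apply Hp|]. exact Hs.
Qed.

Lemma Cmod_horizontal (s t y : R) : Cmod ((s, y) - (t, y) : C) = Rabs (s - t).
Proof.
  replace ((s, y) - (t, y) : C) with (RtoC (s - t)). { apply Cmod_R. }
  unfold RtoC, Cminus, Cplus, Copp; simpl. f_equal; ring.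
Qed.

Lemma Cmod_vertical (s t x : R) : Cmod ((x, s) - (x, t) : C) = Rabs (s - t).
Proof.
  replace ((x, s) - (x, t) : C) with (Ci * RtoC (s - t)).
  { rewrite Cmod_mult, Cmod_Ci, Cmod_R. ring. }
  unfold RtoC, Cmult, Ci, Cminus, Cplus, Copp; simpl. f_equal; ring.
Qed.

Definition in_rect (x1 x2 y1 y2 : R) (z : C) : Prop :=
  (x1 <= Re z <= x2 /\ y1 <= Im z <= y2)%R.

Definition rect_int (g : C -> C) (x1 x2 y1 y2 : R) : C :=
  CInt (fun x => g (x, y1)) x1 x2 - CInt (fun x => g (x, y2)) x1 x2
  + Ci * (CInt (fun y => g (x2, y)) y1 y2 - CInt (fun y => g (x1, y)) y1 y2).

Lemma CInt_correct_h g x1 x2 y : (x1 <= x2)%R ->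
  (forall x, (x1 <= x <= x2)%R -> ccontinuous g (x, y)) ->
  is_CInt (fun x => g (x, y)) x1 x2 (CInt (fun x => g (x, y)) x1 x2).
Proof.
  intros H Hc. apply (RInt_correct (V := C_R_CompleteNormedModule)).
  apply (ex_RInt_continuous (V := C_R_CompleteNormedModule)).
  rewrite Rmin_left, Rmax_right by assumption. intros x Hx.
  apply (ccontinuous_line g (fun x => (x, y))); auto.
  intros s. right. apply Cmod_horizontal.
Qed.

Lemma CInt_correct_v g x y1 y2 : (y1 <= y2)%R ->
  (forall y, (y1 <= y <= y2)%R -> ccontinuous g (x, y)) ->
  is_CInt (fun y => g (x, y)) y1 y2 (CInt (fun y => g (x, y)) y1 y2).
Proof.
  intros H Hc. apply (RInt_correct (V := C_R_CompleteNormedModule)).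
  apply (ex_RInt_continuous (V := C_R_CompleteNormedModule)).
  rewrite Rmin_left, Rmax_right by assumption. intros y Hy.
  apply (ccontinuous_line g (fun y => (x, y))); auto.
  intros s. right. apply Cmod_vertical.
Qed.

Definition on_boundary (x1 x2 y1 y2 : R) (z : C) : Prop :=
  in_rect x1 x2 y1 y2 z /\ (Re z = x1 \/ Re z = x2 \/ Im z = y1 \/ Im z = y2).

(** The boundary is run through counterclockwise. The relational form carries the
    integrability of the four sides, which makes linearity unconditional. *)
Definition is_rect_int (g : C -> C) (x1 x2 y1 y2 : R) (I : C) : Prop :=
  exists b t r l, is_CInt (fun x => g (x, y1)) x1 x2 b /\
    is_CInt (fun x => g (x, y2)) x1 x2 t /\
    is_CInt (fun y => g (x2, y)) y1 y2 r /\
    is_CInt (fun y => g (x1, y)) y1 y2 l /\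
    I = b - t + Ci * (r - l).

Lemma is_rect_int_unique g x1 x2 y1 y2 I :
  is_rect_int g x1 x2 y1 y2 I -> rect_int g x1 x2 y1 y2 = I.
Proof.
  intros (b & t & r & l & Hb & Ht & Hr & Hl & ->).
  apply is_CInt_unique in Hb, Ht, Hr, Hl. unfold rect_int. congruence.
Qed.

Lemma rect_int_correct g x1 x2 y1 y2 : (x1 <= x2)%R -> (y1 <= y2)%R ->
  (forall z, on_boundary x1 x2 y1 y2 z -> ccontinuous g z) ->
  is_rect_int g x1 x2 y1 y2 (rect_int g x1 x2 y1 y2).
Proof.
  intros Hx Hy H. do 4 eexists.
  repeat split; [apply CInt_correct_h|apply CInt_correct_h|apply CInt_correct_v|apply CInt_correct_v];
    try assumption; intros u Hu; apply H; unfold on_boundary, in_rect; simpl; intuition lra.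
Qed.

Lemma is_rect_int_plus g h x1 x2 y1 y2 I J :
  is_rect_int g x1 x2 y1 y2 I -> is_rect_int h x1 x2 y1 y2 J ->
  is_rect_int (fun z => g z + h z) x1 x2 y1 y2 (I + J).
Proof.
  intros (b & t & r & l & Hb & Ht & Hr & Hl & ->) (b' & t' & r' & l' & Hb' & Ht' & Hr' & Hl' & ->).
  exists (b + b'), (t + t'), (r + r'), (l + l').
  repeat split; [apply (is_CInt_plus (fun x => g (x, y1)))|apply (is_CInt_plus (fun x => g (x, y2)))|
    apply (is_CInt_plus (fun y => g (x2, y)))|apply (is_CInt_plus (fun y => g (x1, y)))|]; auto. ring.
Qed.

Lemma is_rect_int_scal c g x1 x2 y1 y2 I :
  is_rect_int g x1 x2 y1 y2 I ->
  is_rect_int (fun z => c * g z) x1 x2 y1 y2 (c * I).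
Proof.
  intros (b & t & r & l & Hb & Ht & Hr & Hl & ->).
  exists (c * b), (c * t), (c * r), (c * l).
  repeat split; [apply (is_CInt_scal c (fun x => g (x, y1)))|apply (is_CInt_scal c (fun x => g (x, y2)))|
    apply (is_CInt_scal c (fun y => g (x2, y)))|apply (is_CInt_scal c (fun y => g (x1, y)))|]; auto. ring.
Qed.

Lemma is_rect_int_ext g h x1 x2 y1 y2 I : (x1 <= x2)%R -> (y1 <= y2)%R ->
  (forall z, on_boundary x1 x2 y1 y2 z -> g z = h z) ->
  is_rect_int g x1 x2 y1 y2 I -> is_rect_int h x1 x2 y1 y2 I.
Proof.
  intros Hx Hy E (b & t & r & l & Hb & Ht & Hr & Hl & ->).
  exists b, t, r, l.
  repeat split;
    [refine (is_RInt_ext (V := C_R_NormedModule) _ _ _ _ _ _ Hb)|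
     refine (is_RInt_ext (V := C_R_NormedModule) _ _ _ _ _ _ Ht)|
     refine (is_RInt_ext (V := C_R_NormedModule) _ _ _ _ _ _ Hr)|
     refine (is_RInt_ext (V := C_R_NormedModule) _ _ _ _ _ _ Hl)];
    intros u Hu; rewrite Rmin_left, Rmax_right in Hu by assumption;
    apply E; unfold on_boundary, in_rect; simpl; intuition lra.
Qed.

Lemma is_rect_int_bound g x1 x2 y1 y2 I M : (x1 <= x2)%R -> (y1 <= y2)%R ->
  (forall z, on_boundary x1 x2 y1 y2 z -> (Cmod (g z) <= M)%R) ->
  is_rect_int g x1 x2 y1 y2 I ->
  (Cmod I <= 2 * ((x2 - x1) + (y2 - y1)) * M)%R.
Proof.
  intros Hx Hy E (b & t & r & l & Hb & Ht & Hr & Hl & ->).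
  apply is_CInt_bound with (M := M) in Hb; [|assumption|];
  [apply is_CInt_bound with (M := M) in Ht; [|assumption|];
  [apply is_CInt_bound with (M := M) in Hr; [|assumption|];
  [apply is_CInt_bound with (M := M) in Hl; [|assumption|]|]|]|];
  try (intros u Hu; apply E; unfold on_boundary, in_rect; simpl; intuition lra).
  assert (H1 := Cmod_triangle (b - t) (Ci * (r - l))).
  rewrite Cmod_mult, Cmod_Ci in H1.
  assert (H2 := Cmod_triangle b (- t)). assert (H3 := Cmod_triangle r (- l)).
  rewrite Cmod_opp in H2, H3. unfold Cminus in *. lra.
Qed.

Lemma is_rect_int_const c x1 x2 y1 y2 : is_rect_int (fun _ => c) x1 x2 y1 y2 0.
Proof.
  exists (scal (V := C_R_NormedModule) (x2 - x1)%R c), (scal (V := C_R_NormedModule) (x2 - x1)%R c),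
    (scal (V := C_R_NormedModule) (y2 - y1)%R c), (scal (V := C_R_NormedModule) (y2 - y1)%R c).
  repeat split; try apply (is_RInt_const (V := C_R_NormedModule)). ring.
Qed.

Lemma is_RInt_id a b : is_RInt (fun x : R => x) a b ((b * b - a * a) / 2)%R.
Proof.
  replace ((b * b - a * a) / 2)%R with (minus (b * b / 2) (a * a / 2))%R
    by (unfold minus, plus, opp; simpl; field).
  apply (is_RInt_derive (V := R_CompleteNormedModule) (fun x => x * x / 2)%R (fun x => x)).
  - intros x _. auto_derive; auto. field.
  - intros x _. apply continuous_id.
Qed.

Lemma is_rect_int_id x1 x2 y1 y2 : is_rect_int (fun z => z) x1 x2 y1 y2 0.
Proof.
  exists ((x2 * x2 - x1 * x1) / 2, (x2 - x1) * y1)%R, ((x2 * x2 - x1 * x1) / 2, (x2 - x1) * y2)%R,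
    ((y2 - y1) * x2, (y2 * y2 - y1 * y1) / 2)%R, ((y2 - y1) * x1, (y2 * y2 - y1 * y1) / 2)%R.
  repeat split; try (apply is_CInt_iff; simpl; split;
    apply is_RInt_id || apply (is_RInt_const (V := R_NormedModule))).
  unfold Ci, Cmult, Cplus, Cminus, Copp, RtoC; simpl. f_equal; field.
Qed.

Lemma is_CInt_Chasles f a b c l m : is_CInt f a b l -> is_CInt f b c m ->
  is_CInt f a c (l + m).
Proof. exact (is_RInt_Chasles (V := C_R_NormedModule) f a b c l m). Qed.

(** Continuity is only required on the sides and on the cut, so that the integrand
    may be singular inside either half. *)
Lemma rect_int_split_x g x1 m x2 y1 y2 : (x1 <= m <= x2)%R -> (y1 <= y2)%R ->
  (forall z, on_boundary x1 x2 y1 y2 z \/ (in_rect x1 x2 y1 y2 z /\ Re z = m) -> ccontinuous g z) ->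
  rect_int g x1 x2 y1 y2 = rect_int g x1 m y1 y2 + rect_int g m x2 y1 y2.
Proof.
  intros Hm Hy H.
  destruct (rect_int_correct g x1 m y1 y2) as (b & t & r & l & Hb & Ht & Hr & Hl & E); try lra.
  { intros z [[? ?] ?]. apply H. unfold on_boundary, in_rect. intuition lra. }
  destruct (rect_int_correct g m x2 y1 y2) as (b' & t' & r' & l' & Hb' & Ht' & Hr' & Hl' & E'); try lra.
  { intros z [[? ?] ?]. apply H. unfold on_boundary, in_rect. intuition lra. }
  rewrite E, E'. apply is_rect_int_unique.
  exists (b + b'), (t + t'), r', l. repeat split; try eapply is_CInt_Chasles; eauto.
  apply is_CInt_unique in Hr, Hl'. replace l' with r by congruence. ring.
Qed.

Lemma rect_int_split_y g x1 x2 y1 m y2 : (x1 <= x2)%R -> (y1 <= m <= y2)%R ->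
  (forall z, on_boundary x1 x2 y1 y2 z \/ (in_rect x1 x2 y1 y2 z /\ Im z = m) -> ccontinuous g z) ->
  rect_int g x1 x2 y1 y2 = rect_int g x1 x2 y1 m + rect_int g x1 x2 m y2.
Proof.
  intros Hm Hy H.
  destruct (rect_int_correct g x1 x2 y1 m) as (b & t & r & l & Hb & Ht & Hr & Hl & E); try lra.
  { intros z [[? ?] ?]. apply H. unfold on_boundary, in_rect. intuition lra. }
  destruct (rect_int_correct g x1 x2 m y2) as (b' & t' & r' & l' & Hb' & Ht' & Hr' & Hl' & E'); try lra.
  { intros z [[? ?] ?]. apply H. unfold on_boundary, in_rect. intuition lra. }
  rewrite E, E'. apply is_rect_int_unique.
  exists b, t', (r + r'), (l + l'). repeat split; try eapply is_CInt_Chasles; eauto.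
  apply is_CInt_unique in Hb', Ht. replace b' with t by congruence. ring.
Qed.

(** * Goursat's theorem *)

Lemma nested_intervals (a b : nat -> R) :
  (forall n, a n <= a (S n) /\ b (S n) <= b n /\ a n <= b n)%R ->
  exists x, forall n, (a n <= x <= b n)%R.
Proof.
  intros H.
  assert (Ha : forall n m, (n <= m)%nat -> (a n <= a m)%R).
  { intros n m nm. induction nm; [lra|]. destruct (H m). lra. }
  assert (Hb : forall n m, (n <= m)%nat -> (b m <= b n)%R).
  { intros n m nm. induction nm; [lra|]. destruct (H m) as (_ & ? & _). lra. }
  assert (Hab : forall n m, (a n <= b m)%R).
  { intros n m. destruct (Nat.le_ge_cases n m) as [L|L].
    - apply Rle_trans with (a m); [auto|apply H].
    - apply Rle_trans with (b n); [apply H|auto]. }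
  destruct (completeness (fun x => exists n, x = a n)) as [x [Ub Lub]].
  - exists (b 0%nat). intros y [n ->]. apply Hab.
  - exists (a 0%nat), 0%nat. reflexivity.
  - exists x. intros n. split.
    + apply Ub. exists n. reflexivity.
    + apply Lub. intros y [m ->]. apply Hab.
Qed.

Lemma Cmod_le_Re_Im (z : C) : (Cmod z <= Rabs (Re z) + Rabs (Im z))%R.
Proof.
  destruct z as [x y]; simpl.
  replace ((x, y) : C) with (RtoC x + Ci * RtoC y).
  - eapply Rle_trans; [apply Cmod_triangle|]. rewrite Cmod_mult, Cmod_Ci, !Cmod_R. lra.
  - unfold RtoC, Ci, Cplus, Cmult; simpl. f_equal; ring.
Qed.

Lemma Cmod_in_rect x1 x2 y1 y2 z w : in_rect x1 x2 y1 y2 z -> in_rect x1 x2 y1 y2 w ->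
  (Cmod (z - w) <= (x2 - x1) + (y2 - y1))%R.
Proof.
  intros [Hz1 Hz2] [Hw1 Hw2]. eapply Rle_trans; [apply Cmod_le_Re_Im|].
  destruct z as [z1 z2], w as [w1 w2]; simpl in *.
  apply Rplus_le_compat; apply Rabs_le; lra.
Qed.

(** Affine functions integrate to zero over a closed contour, so only the error of
    the affine approximation at [c] contributes. *)
Lemma rect_int_small g x1 x2 y1 y2 c l e :
  (x1 <= x2)%R -> (y1 <= y2)%R -> (0 <= e)%R ->
  (forall z, in_rect x1 x2 y1 y2 z -> ccontinuous g z) ->
  in_rect x1 x2 y1 y2 c ->
  (forall z, in_rect x1 x2 y1 y2 z ->
     (Cmod (g z - g c - l * (z - c)) <= e * Cmod (z - c))%R) ->
  (Cmod (rect_int g x1 x2 y1 y2) <= 2 * e * ((x2 - x1) + (y2 - y1)) ^ 2)%R.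
Proof.
  intros Hx Hy He Hg Hc Hd.
  assert (Hg' : is_rect_int g x1 x2 y1 y2 (rect_int g x1 x2 y1 y2)).
  { apply rect_int_correct; auto. intros z [Hz _]; auto. }
  assert (Hr : is_rect_int (fun z => g z - g c - l * (z - c)) x1 x2 y1 y2 (rect_int g x1 x2 y1 y2)).
  { replace (rect_int g x1 x2 y1 y2) with (rect_int g x1 x2 y1 y2 + (0 + (- l) * 0)) by ring.
    refine (is_rect_int_ext _ _ _ _ _ _ _ Hx Hy _ (is_rect_int_plus _ _ _ _ _ _ _ _ Hg'
      (is_rect_int_plus _ _ _ _ _ _ _ _ (is_rect_int_const (l * c - g c) x1 x2 y1 y2)
        (is_rect_int_scal (- l) _ _ _ _ _ _ (is_rect_int_id x1 x2 y1 y2))))).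
    intros z _. simpl. ring. }
  eapply Rle_trans.
  - apply (is_rect_int_bound (fun z => g z - g c - l * (z - c)) _ _ _ _ _ (e * ((x2 - x1) + (y2 - y1))) Hx Hy); [|exact Hr].
    intros z [Hz _]. eapply Rle_trans; [apply Hd, Hz|].
    apply Rmult_le_compat_l; auto. apply Cmod_in_rect; assumption.
  - right. ring.
Qed.

Record rect := Rect { left_side : R; right_side : R; bottom_side : R; top_side : R }.

Definition inside (r : rect) : C -> Prop := in_rect (left_side r) (right_side r) (bottom_side r) (top_side r).

Definition integral (g : C -> C) (r : rect) : C := rect_int g (left_side r) (right_side r) (bottom_side r) (top_side r).

Definition mid (a b : R) : R := ((a + b) / 2)%R.

Definition quarters (r : rect) : list rect :=
  let '(Rect a b c d) := r in
  Rect a (mid a b) c (mid c d) :: Rect a (mid a b) (mid c d) d ::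
  Rect (mid a b) b c (mid c d) :: Rect (mid a b) b (mid c d) d :: nil.

(** The four contour integrals add up to the one over the large rectangle, so one of
    them is at least a quarter of it. *)
Lemma quarter_large g r : (left_side r <= right_side r)%R -> (bottom_side r <= top_side r)%R ->
  (forall z, inside r z -> ccontinuous g z) ->
  exists q, In q (quarters r) /\ (Cmod (integral g r) <= 4 * Cmod (integral g q))%R.
Proof.
  destruct r as [a b c d]; unfold inside, integral; simpl. intros Hx Hy Hg.
  assert (Hm : (a <= mid a b <= b)%R) by (unfold mid; lra).
  assert (Hm' : (c <= mid c d <= d)%R) by (unfold mid; lra).
  rewrite (rect_int_split_x g a (mid a b) b) by (auto; intros z [[? _]|[? _]]; auto).
  rewrite (rect_int_split_y g a (mid a b) c (mid c d) d); try lra.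
  2:{ intros z Hz; apply Hg; unfold on_boundary, in_rect in *; intuition lra. }
  rewrite (rect_int_split_y g (mid a b) b c (mid c d) d); try lra.
  2:{ intros z Hz; apply Hg; unfold on_boundary, in_rect in *; intuition lra. }
  set (I1 := rect_int g a (mid a b) c (mid c d)).
  set (I2 := rect_int g a (mid a b) (mid c d) d).
  set (I3 := rect_int g (mid a b) b c (mid c d)).
  set (I4 := rect_int g (mid a b) b (mid c d) d).
  assert (T := Cmod_triangle (I1 + I2) (I3 + I4)).
  assert (T1 := Cmod_triangle I1 I2). assert (T2 := Cmod_triangle I3 I4).
  set (J := Cmod (I1 + I2 + (I3 + I4))) in *.
  destruct (Rle_dec J (4 * Cmod I1)); [eexists; split; [left; reflexivity|assumption]|].
  destruct (Rle_dec J (4 * Cmod I2)); [eexists; split; [right; left; reflexivity|assumption]|].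
  destruct (Rle_dec J (4 * Cmod I3)); [eexists; split; [right; right; left; reflexivity|assumption]|].
  eexists; split; [right; right; right; left; reflexivity|]. unfold I4 in *; simpl in *. lra.
Qed.

Lemma quarter_shape r q : In q (quarters r) ->
  (left_side r <= right_side r)%R -> (bottom_side r <= top_side r)%R ->
  (left_side r <= left_side q <= right_side q)%R /\ (right_side q <= right_side r)%R /\
  (bottom_side r <= bottom_side q <= top_side q)%R /\ (top_side q <= top_side r)%R /\
  (right_side q - left_side q = (right_side r - left_side r) / 2)%R /\
  (top_side q - bottom_side q = (top_side r - bottom_side r) / 2)%R.
Proof.
  destruct r as [a b c d]; simpl. unfold mid.
  intros [<-|[<-|[<-|[<-|[]]]]] Hx Hy; simpl; lra.
Qed.

(** Keep choosing a quarter that carries at least a quarter of the integral. The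
    quarters shrink to a point, where differentiability makes the integral small
    compared with the squared size of the rectangle, that is, with the factor [4 ^ n]
    lost in [n] steps. *)
Theorem Goursat g x1 x2 y1 y2 : (x1 <= x2)%R -> (y1 <= y2)%R ->
  (forall z, in_rect x1 x2 y1 y2 z -> exists l, has_cderiv g z l) ->
  rect_int g x1 x2 y1 y2 = 0.
Proof.
  intros Hx Hy Hg.
  assert (Hc : forall z, in_rect x1 x2 y1 y2 z -> ccontinuous g z).
  { intros z Hz. destruct (Hg z Hz) as [l Hl]. exact (has_cderiv_ccontinuous _ _ _ Hl). }
  set (ok := fun r => (x1 <= left_side r <= right_side r)%R /\ (right_side r <= x2)%R /\
    (y1 <= bottom_side r <= top_side r)%R /\ (top_side r <= y2)%R).
  assert (Hnext : forall r, exists q, ok r ->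
    In q (quarters r) /\ (Cmod (integral g r) <= 4 * Cmod (integral g q))%R).
  { intros r. destruct (classic (ok r)) as [Hr|Hr]; [|exists r; tauto].
    destruct (quarter_large g r) as [q Hq]; try (unfold ok in Hr; lra).
    - intros z [? ?]; apply Hc. unfold ok in Hr. unfold in_rect. lra.
    - exists q; auto. }
  set (next := fun r => proj1_sig (constructive_indefinite_description _ (Hnext r))).
  assert (Hn : forall r, ok r ->
    In (next r) (quarters r) /\ (Cmod (integral g r) <= 4 * Cmod (integral g (next r)))%R).
  { intros r. unfold next. destruct constructive_indefinite_description as [q Hq]. exact Hq. }
  set (s := fun n => Nat.iter n next (Rect x1 x2 y1 y2)).
  assert (Hs : forall n, ok (s n) /\
     (right_side (s n) - left_side (s n) = (x2 - x1) / 2 ^ n)%R /\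
     (top_side (s n) - bottom_side (s n) = (y2 - y1) / 2 ^ n)%R /\
     (Cmod (rect_int g x1 x2 y1 y2) <= 4 ^ n * Cmod (integral g (s n)))%R).
  { induction n as [|n [IH [IHx [IHy IHi]]]].
    - unfold ok, s, integral; simpl. repeat split; lra.
    - destruct (Hn _ IH) as [Hq Hi].
      change (next (s n)) with (s (S n)) in *.
      apply quarter_shape in Hq; [|unfold ok in IH; lra..].
      destruct Hq as (? & ? & ? & ? & E1 & E2). unfold ok in *.
      repeat split; try lra.
      + rewrite E1, IHx. simpl. field. apply pow_nonzero. lra.
      + rewrite E2, IHy. simpl. field. apply pow_nonzero. lra.
      + eapply Rle_trans; [exact IHi|].
        replace (4 ^ S n)%R with (4 ^ n * 4)%R by (simpl; ring). rewrite Rmult_assoc.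
        apply Rmult_le_compat_l; [apply pow_le; lra|exact Hi]. }
  assert (Hs' : forall n, In (s (S n)) (quarters (s n))).
  { intros n. apply Hn. apply Hs. }
  destruct (nested_intervals (fun n => left_side (s n)) (fun n => right_side (s n))) as [x Hxs].
  { intros n. destruct (Hs n) as [[? [? [? ?]]] _]. destruct (quarter_shape _ _ (Hs' n)); lra. }
  destruct (nested_intervals (fun n => bottom_side (s n)) (fun n => top_side (s n))) as [y Hys].
  { intros n. destruct (Hs n) as [[? [? [? ?]]] _]. destruct (quarter_shape _ _ (Hs' n)); lra. }
  assert (Hin : forall n, inside (s n) (x, y)).
  { intros n. split; simpl; auto. }
  destruct (Hg (x, y)) as [l Hl]; [exact (Hin 0%nat)|].
  set (D := ((x2 - x1) + (y2 - y1))%R). assert (0 <= D)%R by (unfold D; lra).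
  apply Cmod_eq_0. apply Rle_antisym; [|apply Cmod_ge_0].
  apply le_epsilon. intros e He. rewrite Rplus_0_l.
  set (e' := (e / (2 * (D ^ 2 + 1)))%R).
  assert (He' : (0 < e')%R) by (apply Rdiv_lt_0_compat; nra).
  destruct (Hl e' He') as [d [d0 Hd]].
  destruct (pow_lt_1_zero (/ 2) ltac:(rewrite Rabs_pos_eq; lra) (d / (D + 1)) ltac:(apply Rdiv_lt_0_compat; lra)) as [n Hnd].
  specialize (Hnd n (Nat.le_refl n)). rewrite Rabs_pos_eq in Hnd by (apply pow_le; lra).
  rewrite pow_inv in Hnd.
  destruct (Hs n) as [Hok [Ex [Ey Ei]]].
  assert (P2 : (0 < 2 ^ n)%R) by (apply pow_lt; lra).
  assert (Dn : (D / 2 ^ n < d)%R).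
  { unfold Rdiv. apply Rle_lt_trans with ((D + 1) * / 2 ^ n)%R.
    - apply Rmult_le_compat_r; [left; apply Rinv_0_lt_compat; auto|lra].
    - apply (Rmult_lt_compat_l (D + 1)) in Hnd; [|lra].
      replace d with ((D + 1) * (d / (D + 1)))%R by (field; lra). exact Hnd. }
  assert (B : (Cmod (integral g (s n)) <= 2 * e' * (D / 2 ^ n) ^ 2)%R).
  { replace (D / 2 ^ n)%R with ((right_side (s n) - left_side (s n)) + (top_side (s n) - bottom_side (s n)))%R
      by (rewrite Ex, Ey; unfold D; field; lra).
    apply (rect_int_small g _ _ _ _ (x, y) l); try (unfold ok in Hok; lra).
    - intros z [? ?]. apply Hc. unfold ok in Hok. unfold in_rect. lra.
    - apply Hin.
    - intros z Hz. apply Hd. eapply Rle_lt_trans; [apply (Cmod_in_rect _ _ _ _ _ _ Hz (Hin n))|].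
      rewrite Ex, Ey. replace (_ + _)%R with (D / 2 ^ n)%R; [exact Dn|]. unfold D. field. lra. }
  eapply Rle_trans; [exact Ei|].
  apply Rle_trans with (4 ^ n * (2 * e' * (D / 2 ^ n) ^ 2))%R.
  { apply Rmult_le_compat_l; auto. apply pow_le. lra. }
  replace (4 ^ n)%R with (2 ^ n * 2 ^ n)%R by (rewrite <- Rpow_mult_distr; f_equal; lra).
  unfold e'. replace (2 ^ n * 2 ^ n * (2 * (e / (2 * (D ^ 2 + 1))) * (D / 2 ^ n) ^ 2))%R
    with (e * (D ^ 2 / (D ^ 2 + 1)))%R by (field; split; nra).
  assert (D ^ 2 / (D ^ 2 + 1) <= 1)%R.
  { apply Rmult_le_reg_r with (D ^ 2 + 1)%R; [nra|]. unfold Rdiv. rewrite Rmult_assoc, Rinv_l; nra. }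
  nra.
Qed.

(** * Cauchy's integral formula *)

(** The four strips around the inner rectangle contribute nothing, since the integrand
    is holomorphic on them. *)
Lemma rect_int_shrink g x1 a1 a2 x2 y1 b1 b2 y2 :
  (x1 <= a1 <= a2)%R -> (a2 <= x2)%R -> (y1 <= b1 <= b2)%R -> (b2 <= y2)%R ->
  (forall z, in_rect x1 x2 y1 y2 z -> ~ (a1 < Re z < a2 /\ b1 < Im z < b2)%R ->
     exists l, has_cderiv g z l) ->
  rect_int g x1 x2 y1 y2 = rect_int g a1 a2 b1 b2.
Proof.
  intros Hx Hx' Hy Hy' H.
  assert (Hc : forall z, in_rect x1 x2 y1 y2 z -> ~ (a1 < Re z < a2 /\ b1 < Im z < b2)%R ->
     ccontinuous g z).
  { intros z Hz Hz'. destruct (H z Hz Hz') as [l Hl]. exact (has_cderiv_ccontinuous _ _ _ Hl). }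
  rewrite (rect_int_split_x g x1 a1 x2); [|lra|lra|].
  2:{ intros z Hz; apply Hc; unfold on_boundary, in_rect in *; intuition lra. }
  rewrite (Goursat g x1 a1); [|lra|lra|].
  2:{ intros z Hz; apply H; unfold in_rect in *; intuition lra. }
  rewrite (rect_int_split_x g a1 a2 x2); [|lra|lra|].
  2:{ intros z Hz; apply Hc; unfold on_boundary, in_rect in *; intuition lra. }
  rewrite (Goursat g a2 x2); [|lra|lra|].
  2:{ intros z Hz; apply H; unfold in_rect in *; intuition lra. }
  rewrite (rect_int_split_y g a1 a2 y1 b1 y2); [|lra|lra|].
  2:{ intros z Hz; apply Hc; unfold on_boundary, in_rect in *; intuition lra. }
  rewrite (Goursat g a1 a2 y1 b1); [|lra|lra|].
  2:{ intros z Hz; apply H; unfold in_rect in *; intuition lra. }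
  rewrite (rect_int_split_y g a1 a2 b1 b2 y2); [|lra|lra|].
  2:{ intros z Hz; apply Hc; unfold on_boundary, in_rect in *; intuition lra. }
  rewrite (Goursat g a1 a2 b2 y2); [|lra|lra|].
  2:{ intros z Hz; apply H; unfold in_rect in *; intuition lra. }
  ring.
Qed.

Lemma sum_sq_neq_0 (u h : R) : (0 < h)%R -> (u ^ 2 + h ^ 2)%R <> 0%R.
Proof. intros Hh. assert (E := pow2_ge_0 u). assert (0 < h ^ 2)%R by (apply pow_lt; lra). lra. Qed.

Lemma is_RInt_Poisson (p h : R) : (0 < h)%R ->
  is_RInt (fun x => 2 * h / ((x - p) ^ 2 + h ^ 2))%R (p - h) (p + h) PI.
Proof.
  intros Hh.
  replace PI with (minus (2 * atan ((p + h - p) / h)) (2 * atan ((p - h - p) / h)))%R.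
  - apply (is_RInt_derive (V := R_CompleteNormedModule) (fun x => 2 * atan ((x - p) / h))%R).
    + intros x _. auto_derive; [auto|]. field. split; [apply sum_sq_neq_0|]; lra.
    + intros x _. apply (ex_derive_continuous (K := R_AbsRing) (V := R_NormedModule)). auto_derive. apply (sum_sq_neq_0 (x - p) h Hh).
  - replace ((p + h - p) / h)%R with 1%R by (field; lra).
    replace ((p - h - p) / h)%R with (- (1))%R by (field; lra).
    rewrite atan_opp, atan_1. unfold minus, plus, opp; simpl. field.
Qed.

(** Opposite sides of a square centered at [(p, q)] combine to the Poisson kernel,
    whose primitive is an arctangent. *)
Lemma rect_int_inv_center (p q h : R) : (0 < h)%R ->
  rect_int (fun z => / (z - (p, q))) (p - h) (p + h) (q - h) (q + h) = 2 * PI * Ci.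
Proof.
  intros Hh.
  assert (Hc : forall z, on_boundary (p - h) (p + h) (q - h) (q + h) z -> ccontinuous (fun z => / (z - (p, q))) z).
  { intros z Hz. destruct (has_cderiv_inv_sub (p, q) z) as [l Hl].
    - intros ->. unfold on_boundary, in_rect in Hz. simpl in Hz. intuition lra.
    - exact (has_cderiv_ccontinuous _ _ _ Hl). }
  destruct (rect_int_correct (fun z => / (z - (p, q))) (p - h) (p + h) (q - h) (q + h) ltac:(lra) ltac:(lra) Hc) as (b & t & r & l & Hb & Ht & Hr & Hl & ->).
  assert (Hbt : is_CInt (fun x => (0, 2 * h / ((x - p) ^ 2 + h ^ 2))%R) (p - h) (p + h) (b - t)).
  { eapply is_CInt_ext; [|exact (is_CInt_minus _ _ _ _ _ _ Hb Ht)]. intros x. simpl.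
    unfold Cinv, Cminus, Cplus, Copp, RtoC; simpl. f_equal; field;
      assert (E := sum_sq_neq_0 (x - p) h Hh); repeat split; contradict E; rewrite <- E; ring. }
  assert (Hrl : is_CInt (fun y => (2 * h / ((y - q) ^ 2 + h ^ 2), 0)%R) (q - h) (q + h) (r - l)).
  { eapply is_CInt_ext; [|exact (is_CInt_minus _ _ _ _ _ _ Hr Hl)]. intros x. simpl.
    unfold Cinv, Cminus, Cplus, Copp, RtoC; simpl. f_equal; field;
      assert (E := sum_sq_neq_0 (x - q) h Hh); repeat split; contradict E; rewrite <- E; ring. }
  assert (Z : forall u v, is_RInt (fun _ => 0%R) u v 0%R).
  { intros u v. assert (H := is_RInt_const (V := R_NormedModule) u v 0%R).
    exact (eq_rect _ (fun w => is_RInt (fun _ => 0%R) u v w) H _ (Rmult_0_r (v - u))). }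
  assert (Ebt : b - t = (0, PI)%R).
  { rewrite <- (is_CInt_unique _ _ _ _ Hbt). apply is_CInt_unique, is_CInt_iff. simpl.
    split; [apply Z|apply is_RInt_Poisson; exact Hh]. }
  assert (Erl : r - l = (PI, 0)%R).
  { rewrite <- (is_CInt_unique _ _ _ _ Hrl). apply is_CInt_unique, is_CInt_iff. simpl.
    split; [apply is_RInt_Poisson; exact Hh|apply Z]. }
  rewrite Ebt, Erl. unfold Ci, Cmult, Cplus, RtoC; simpl. f_equal; ring.
Qed.

(** The contour can be shrunk to a small square around [a]. There [f] differs from
    [f a] by a bounded multiple of [z - a], so replacing [f] by [f a] costs no more
    than a multiple of the length of the contour. *)
Theorem Cauchy_formula f x1 x2 y1 y2 a :
  (x1 < Re a < x2)%R -> (y1 < Im a < y2)%R ->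
  (forall z, in_rect x1 x2 y1 y2 z -> exists l, has_cderiv f z l) ->
  rect_int (fun z => f z * / (z - a)) x1 x2 y1 y2 = 2 * PI * Ci * f a.
Proof.
  destruct a as [p q]. simpl. intros Hp Hq Hf.
  set (a := (p, q) : C).
  destruct (Hf a) as [l Hl]. { unfold in_rect; simpl; lra. }
  apply Ceq_minus, Cmod_eq_0, Rle_antisym; [|apply Cmod_ge_0].
  apply le_epsilon. intros e He. rewrite Rplus_0_l.
  assert (L0 := Cmod_ge_0 l).
  destruct (Hl 1%R Rlt_0_1) as [d [d0 Hd]].
  set (K := (8 * (1 + Cmod l))%R).
  (* The first four bounds make the square fit into the rectangle, [d / 3] keeps it
     where [f] is nearly affine, and [e / K] makes the contour short. *)
  set (h := Rmin (Rmin (Rmin (p - x1) (x2 - p)) (Rmin (q - y1) (y2 - q))) (Rmin (d / 3) (e / K))).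
  assert (h0 : (0 < h)%R).
  { unfold h. repeat apply Rmin_pos; try lra. apply Rdiv_lt_0_compat; unfold K; lra. }
  assert (hx : (h <= Rmin (p - x1) (x2 - p))%R).
  { unfold h. eapply Rle_trans; [apply Rmin_l|]. apply Rmin_l. }
  assert (hy : (h <= Rmin (q - y1) (y2 - q))%R).
  { unfold h. eapply Rle_trans; [apply Rmin_l|]. apply Rmin_r. }
  assert (hde : (h <= Rmin (d / 3) (e / K))%R) by apply Rmin_r.
  assert (hx1 := Rle_trans _ _ _ hx (Rmin_l _ _)). assert (hx2 := Rle_trans _ _ _ hx (Rmin_r _ _)).
  assert (hy1 := Rle_trans _ _ _ hy (Rmin_l _ _)). assert (hy2 := Rle_trans _ _ _ hy (Rmin_r _ _)).
  assert (hd := Rle_trans _ _ _ hde (Rmin_l _ _)). assert (he := Rle_trans _ _ _ hde (Rmin_r _ _)).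
  clear hx hy hde. clearbody h.
  rewrite (rect_int_shrink _ x1 (p - h) (p + h) x2 y1 (q - h) (q + h) y2); try lra.
  2:{ intros z Hz Hz'. apply has_cderiv_ex_mult; [auto|]. apply has_cderiv_inv_sub.
      intros ->. apply Hz'. simpl. lra. }
  assert (Hna : forall z, on_boundary (p - h) (p + h) (q - h) (q + h) z -> z - a <> 0).
  { intros z Hz. apply Cminus_eq_contra. intros ->. unfold on_boundary, in_rect in Hz; simpl in Hz. intuition lra. }
  assert (Hinv : is_rect_int (fun z => / (z - a)) (p - h) (p + h) (q - h) (q + h) (2 * PI * Ci)).
  { rewrite <- (rect_int_inv_center p q h h0). apply rect_int_correct; try lra.
    intros z Hz. destruct (has_cderiv_inv_sub a z) as [m Hm].
    - intros E. apply (Hna z Hz). rewrite E. ring.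
    - exact (has_cderiv_ccontinuous _ _ _ Hm). }
  assert (Hfz : is_rect_int (fun z => f z * / (z - a)) (p - h) (p + h) (q - h) (q + h)
    (rect_int (fun z => f z * / (z - a)) (p - h) (p + h) (q - h) (q + h))).
  { apply rect_int_correct; try lra.
    intros z Hz. destruct (has_cderiv_ex_mult f (fun z => / (z - a)) z) as [m Hm].
    - apply Hf. destruct Hz as [Hz _]. unfold in_rect in *. lra.
    - apply has_cderiv_inv_sub. intros E. apply (Hna z Hz). rewrite E. ring.
    - exact (has_cderiv_ccontinuous _ _ _ Hm). }
  assert (Hdiff : is_rect_int (fun z => (f z - f a) * / (z - a)) (p - h) (p + h) (q - h) (q + h)
    (rect_int (fun z => f z * / (z - a)) (p - h) (p + h) (q - h) (q + h) - 2 * PI * Ci * f a)).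
  { match goal with |- is_rect_int _ _ _ _ _ (?I - _) =>
      replace (I - 2 * PI * Ci * f a) with (I + (- f a) * (2 * PI * Ci)) by ring end.
    refine (is_rect_int_ext _ _ _ _ _ _ _ _ _ _ (is_rect_int_plus _ _ _ _ _ _ _ _ Hfz
      (is_rect_int_scal (- f a) _ _ _ _ _ _ Hinv))); try lra.
    intros z _. ring. }
  eapply Rle_trans.
  - apply (is_rect_int_bound (fun z => (f z - f a) * / (z - a)) _ _ _ _ _ (1 + Cmod l)) in Hdiff; try lra; [exact Hdiff|].
    intros z Hz. assert (N := Hna z Hz). assert (N' := proj1 (Cmod_gt_0 _) N).
    rewrite Cmod_mult, Cmod_inv by assumption.
    apply Rmult_le_reg_r with (Cmod (z - a)); [assumption|].
    rewrite Rmult_assoc, Rinv_l, Rmult_1_r by lra.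
    replace (f z - f a) with ((f z - f a - l * (z - a)) + l * (z - a)) by ring.
    eapply Rle_trans; [apply Cmod_triangle|]. rewrite Cmod_mult, Rmult_plus_distr_r.
    apply Rplus_le_compat_r. 
    apply Hd. eapply Rle_lt_trans; [apply Cmod_le_Re_Im|].
    destruct Hz as [[Hz1 Hz2] _]. destruct z as [z1 z2]. simpl in *.
    apply Rle_lt_trans with (h + h)%R; [|lra].
    apply Rplus_le_compat; apply Rabs_le; lra.
  - apply Rle_trans with (h * K)%R; [unfold K; right; ring|].
    apply Rmult_le_compat_r with (r := K) in he; [|unfold K; lra].
    replace (e / K * K)%R with e in he by (field; unfold K; lra). exact he.
Qed.

(** * Finite combinations of point evaluations *)

(** Interpolation operators are kept as explicit combinations of point evaluations,
    because the same combination is applied to the kernel in either variable and its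
    coefficients have to be estimated. *)
Definition combination := list (C * C).

Fixpoint eval (l : combination) (f : C -> C) : C :=
  match l with [] => 0 | (c, p) :: l => c * f p + eval l f end.

Fixpoint l1_norm (l : combination) : R :=
  match l with [] => 0%R | (c, p) :: l => (Cmod c + l1_norm l)%R end.

Definition scale (a : C) (l : combination) : combination := map (fun cp => (a * fst cp, snd cp)) l.

Definition supported (l : combination) (S : C -> Prop) : Prop := forall c p, In (c, p) l -> S p.

Lemma eval_app l m f : eval (l ++ m) f = eval l f + eval m f.
Proof. induction l as [|[c p] l IH]; simpl; [ring|]. rewrite IH. ring. Qed.

Lemma eval_scale a l f : eval (scale a l) f = a * eval l f.
Proof. induction l as [|[c p] l IH]; simpl; [ring|]. rewrite IH. ring. Qed.

Lemma l1_norm_app l m : l1_norm (l ++ m) = (l1_norm l + l1_norm m)%R.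
Proof. induction l as [|[c p] l IH]; simpl; [ring|]. rewrite IH. ring. Qed.

Lemma l1_norm_scale a l : l1_norm (scale a l) = (Cmod a * l1_norm l)%R.
Proof. induction l as [|[c p] l IH]; simpl; [ring|]. rewrite IH, Cmod_mult. ring. Qed.

Lemma l1_norm_pos l : (0 <= l1_norm l)%R.
Proof. induction l as [|[c p] l IH]; simpl; [lra|]. assert (H := Cmod_ge_0 c). lra. Qed.

Lemma supported_app l m S : supported l S -> supported m S -> supported (l ++ m) S.
Proof. intros Hl Hm c p H. apply in_app_or in H as [H|H]; eauto. Qed.

Lemma supported_scale a l S : supported l S -> supported (scale a l) S.
Proof.
  intros Hl c p H. apply in_map_iff in H as [[c' p'] [E H]]. injection E as <- <-. eauto.
Qed.

Lemma supported_incl l (S T : C -> Prop) : (forall p, S p -> T p) -> supported l S -> supported l T.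
Proof. intros H Hl c p Hp. eauto. Qed.

Lemma eval_bound l h M : supported l (fun p => (Cmod (h p) <= M)%R) ->
  (Cmod (eval l h) <= l1_norm l * M)%R.
Proof.
  induction l as [|[c p] l IH]; intros H; simpl.
  - rewrite Cmod_0. lra.
  - eapply Rle_trans; [apply Cmod_triangle|]. rewrite Cmod_mult, Rmult_plus_distr_r.
    apply Rplus_le_compat.
    + apply Rmult_le_compat_l; [apply Cmod_ge_0|]. apply (H c). left; reflexivity.
    + apply IH. intros c' p' H'. apply (H c'). right; assumption.
Qed.

(** * Divided differences and Newton interpolation *)

(** The recursion over consecutive nodes divides by the distance of the two extreme
    nodes only, which keeps the coefficients small for nodes on a line. *)
Fixpoint divided_diff (t : nat -> C) (i n : nat) : combination :=
  match n with
  | 0%nat => [(RtoC 1, t i)]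
  | S m => scale (/ (t (i + S m)%nat - t i)) (divided_diff t (S i) m ++ scale (- (1)) (divided_diff t i m))
  end.

Lemma divided_diff_supported t (S : C -> Prop) n : forall i,
  (forall j, (i <= j <= i + n)%nat -> S (t j)) -> supported (divided_diff t i n) S.
Proof.
  induction n as [|n IH]; intros i H; simpl.
  - intros c p [E|[]]. injection E as <- <-. apply H. lia.
  - apply supported_scale, supported_app; [|apply supported_scale]; apply IH; intros j Hj; apply H; lia.
Qed.

(** Each step of the recursion at most doubles the norm and divides it by the distance
    [s * (n + 1)] of the extreme nodes. For [s] of order [1 / N] the bound is
    exponential in [N] rather than of order [N ^ N]. *)
Lemma divided_diff_l1_norm t s N : (0 < s)%R ->
  (forall i j, (i < j <= N)%nat -> (s * INR (j - i) <= Cmod (t j - t i))%R) ->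
  forall n i, (i + n <= N)%nat -> (l1_norm (divided_diff t i n) <= (2 / s) ^ n / INR (fact n))%R.
Proof.
  intros Hs Ht. induction n as [|n IH]; intros i Hi.
  - simpl. rewrite Cmod_1. lra.
  - cbn [divided_diff]. rewrite l1_norm_scale, l1_norm_app, l1_norm_scale, Cmod_opp, Cmod_1, Rmult_1_l.
    assert (H1 := IH (S i) ltac:(lia)). assert (H2 := IH i ltac:(lia)).
    assert (H3 := Ht i (i + S n)%nat ltac:(lia)).
    replace (i + S n - i)%nat with (S n) in H3 by lia.
    assert (Hn : (0 < INR (S n))%R) by (apply lt_0_INR; lia).
    assert (Hsn : (0 < s * INR (S n))%R) by (apply Rmult_lt_0_compat; auto).
    assert (Hf : (0 < INR (fact n))%R) by (apply lt_0_INR, lt_O_fact).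
    rewrite Cmod_inv by (apply Cmod_gt_0; lra).
    apply Rle_trans with (/ (s * INR (S n)) * (2 * ((2 / s) ^ n / INR (fact n))))%R.
    + apply Rmult_le_compat.
      * left. apply Rinv_0_lt_compat. lra.
      * assert (P1 := l1_norm_pos (divided_diff t (S i) n)). assert (P2 := l1_norm_pos (divided_diff t i n)). lra.
      * apply Rinv_le_contravar; lra.
      * lra.
    + right. rewrite fact_simpl, mult_INR. cbn [pow]. field. repeat split; lra.
Qed.

Fixpoint node_product (t : nat -> C) (i n : nat) (z : C) : C :=
  match n with 0%nat => 1 | S m => node_product t i m z * (z - t (i + m)%nat) end.

Lemma node_product_left t i n z : node_product t i (S n) z = (z - t i) * node_product t (S i) n z.
Proof.
  induction n as [|n IH].
  - simpl. rewrite Nat.add_0_r. ring.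
  - change (node_product t i (S (S n)) z) with (node_product t i (S n) z * (z - t (i + S n)%nat)).
    rewrite IH. cbn [node_product]. replace (S i + n)%nat with (i + S n)%nat by lia. ring.
Qed.

Lemma node_product_neq_0 t i n z : (forall j, (i <= j < i + n)%nat -> z <> t j) -> node_product t i n z <> 0.
Proof.
  induction n as [|n IH]; intros H; simpl.
  - apply C1_nz.
  - apply Cmult_neq_0; [apply IH; intros; apply H; lia|]. apply Cminus_eq_contra, H. lia.
Qed.

Lemma node_product_has_cderiv t i n z : exists l, has_cderiv (node_product t i n) z l.
Proof.
  induction n as [|n IH]; simpl.
  - exists 0. apply has_cderiv_const.
  - apply has_cderiv_ex_mult; [exact IH|]. exists 1. apply has_cderiv_sub_const, has_cderiv_id.
Qed.

Lemma node_product_le t i n z r : (forall j, (i <= j < i + n)%nat -> (Cmod (z - t j) <= r)%R) ->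
  (Cmod (node_product t i n z) <= r ^ n)%R.
Proof.
  induction n as [|n IH]; intros H; simpl.
  - rewrite Cmod_1. lra.
  - rewrite Cmod_mult, Rmult_comm. apply Rmult_le_compat; try apply Cmod_ge_0.
    + apply H. lia.
    + apply IH. intros; apply H; lia.
Qed.

Lemma node_product_ge t i n z r : (0 <= r)%R -> (forall j, (i <= j < i + n)%nat -> (r <= Cmod (z - t j))%R) ->
  (r ^ n <= Cmod (node_product t i n z))%R.
Proof.
  intros Hr. induction n as [|n IH]; intros H; simpl.
  - rewrite Cmod_1. lra.
  - rewrite Cmod_mult, (Rmult_comm (Cmod _)). apply Rmult_le_compat; auto.
    + apply pow_le; auto.
    + apply H. lia.
    + apply IH. intros; apply H; lia.
Qed.

Definition open_rect (x1 x2 y1 y2 : R) (a : C) : Prop := (x1 < Re a < x2 /\ y1 < Im a < y2)%R.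

Lemma boundary_not_open_rect x1 x2 y1 y2 a z : open_rect x1 x2 y1 y2 a -> on_boundary x1 x2 y1 y2 z -> z <> a.
Proof. intros H [_ H'] ->. unfold open_rect in H. intuition lra. Qed.

Lemma is_rect_int_has_cderiv f x1 x2 y1 y2 : (x1 <= x2)%R -> (y1 <= y2)%R ->
  (forall z, on_boundary x1 x2 y1 y2 z -> exists l, has_cderiv f z l) ->
  is_rect_int f x1 x2 y1 y2 (rect_int f x1 x2 y1 y2).
Proof.
  intros Hx Hy H. apply rect_int_correct; auto. intros z Hz.
  destruct (H z Hz) as [l Hl]. exact (has_cderiv_ccontinuous _ _ _ Hl).
Qed.

Section Interpolation.

Context (x1 x2 y1 y2 : R) (Hx : (x1 <= x2)%R) (Hy : (y1 <= y2)%R) (f : C -> C)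
  (Hf : forall z, in_rect x1 x2 y1 y2 z -> exists l, has_cderiv f z l).

Lemma Cauchy_is_rect_int a : open_rect x1 x2 y1 y2 a ->
  is_rect_int (fun z => f z * / (z - a)) x1 x2 y1 y2 (2 * PI * Ci * f a).
Proof.
  intros Ha. rewrite <- (Cauchy_formula f x1 x2 y1 y2 a) by (auto; apply Ha).
  apply is_rect_int_has_cderiv; auto. intros z Hz. apply has_cderiv_ex_mult.
  - apply Hf, Hz.
  - apply has_cderiv_inv_sub, (boundary_not_open_rect _ _ _ _ _ _ Ha Hz).
Qed.

(** The recursion for divided differences matches the partial fraction identity for
    reciprocals of products of consecutive factors [z - t j], so Cauchy's formula
    propagates from single nodes to all divided differences. *)
Lemma divided_diff_integral t N : (forall j, (j <= N)%nat -> open_rect x1 x2 y1 y2 (t j)) ->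
  (forall i j, (i < j <= N)%nat -> t j <> t i) ->
  forall n i, (i + n <= N)%nat ->
  is_rect_int (fun z => f z * / node_product t i (S n) z) x1 x2 y1 y2 (2 * PI * Ci * eval (divided_diff t i n) f).
Proof.
  intros Ht Hd. induction n as [|n IH]; intros i Hi.
  - cbn [divided_diff eval]. replace (1 * f (t i) + 0) with (f (t i)) by ring.
    eapply is_rect_int_ext; [..|exact (Cauchy_is_rect_int (t i) (Ht i ltac:(lia)))]; auto.
    intros z _. simpl. rewrite Nat.add_0_r, Cmult_1_l. reflexivity.
  - cbn [divided_diff]. rewrite eval_scale, eval_app, eval_scale.
    set (d := t (i + S n)%nat - t i).
    assert (Hd0 : d <> 0) by (apply Cminus_eq_contra, Hd; lia).
    assert (H1 := IH (S i) ltac:(lia)). assert (H2 := IH i ltac:(lia)).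
    assert (H3 := is_rect_int_scal (/ d) _ _ _ _ _ _ (is_rect_int_plus _ _ _ _ _ _ _ _ H1 (is_rect_int_scal (- (1)) _ _ _ _ _ _ H2))).
    match type of H3 with is_rect_int _ _ _ _ _ ?I =>
      replace (2 * PI * Ci * (/ d * (eval (divided_diff t (S i) n) f + - (1) * eval (divided_diff t i n) f))) with I by ring end.
    eapply is_rect_int_ext; [..|exact H3]; auto.
    intros z Hz.
    assert (Nz : forall j, (j <= N)%nat -> z - t j <> 0).
    { intros j Hj. apply Cminus_eq_contra, (boundary_not_open_rect x1 x2 y1 y2); auto. }
    assert (E : node_product t i (S (S n)) z = node_product t i (S n) z * (z - t (i + S n)%nat)) by reflexivity.
    assert (N1 : node_product t (S i) n z <> 0).
    { apply node_product_neq_0. intros j Hj. apply (boundary_not_open_rect x1 x2 y1 y2); auto. apply Ht. lia. }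
    assert (E1 := node_product_left t i n z).
    assert (E2 : node_product t (S i) (S n) z = node_product t (S i) n z * (z - t (i + S n)%nat)).
    { cbn [node_product]. replace (S i + n)%nat with (i + S n)%nat by lia. reflexivity. }
    rewrite E, E1, E2.
    unfold d in *. field. repeat split; auto; apply Nz; lia.
Qed.

(** Newton's interpolation polynomial at the first [n] nodes, for the point [y]: its
    value for [f] is [eval (newton t n y) f]. *)
Fixpoint newton (t : nat -> C) (n : nat) (y : C) : combination :=
  match n with
  | 0%nat => []
  | S m => newton t m y ++ scale (node_product t 0 m y) (divided_diff t 0 m)
  end.

(** Hermite's remainder formula. Each further Newton term turns [1 / (z - y)] into
    [(y - t n) / ((z - y) * (z - t n))] under the integral sign. *)
Lemma newton_remainder t N y : (forall j, (j <= N)%nat -> open_rect x1 x2 y1 y2 (t j)) ->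
  (forall i j, (i < j <= N)%nat -> t j <> t i) -> open_rect x1 x2 y1 y2 y ->
  forall n, (n <= S N)%nat ->
  is_rect_int (fun z => node_product t 0 n y * (f z * / (node_product t 0 n z * (z - y)))) x1 x2 y1 y2
    (2 * PI * Ci * (f y - eval (newton t n y) f)).
Proof.
  intros Ht Hd Hyi. induction n as [|n IH]; intros Hn.
  - simpl. replace (f y - 0) with (f y) by ring.
    eapply is_rect_int_ext; [..|exact (Cauchy_is_rect_int y Hyi)]; auto.
    intros z _. simpl. rewrite !Cmult_1_l. reflexivity.
  - cbn [newton]. rewrite eval_app, eval_scale.
    assert (H1 := IH ltac:(lia)). assert (H2 := divided_diff_integral t N Ht Hd n 0%nat ltac:(lia)).
    assert (H3 := is_rect_int_plus _ _ _ _ _ _ _ _ H1 (is_rect_int_scal (- node_product t 0 n y) _ _ _ _ _ _ H2)).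
    match type of H3 with is_rect_int _ _ _ _ _ ?I =>
      replace (2 * PI * Ci * (f y - (eval (newton t n y) f + node_product t 0 n y * eval (divided_diff t 0 n) f))) with I by ring end.
    eapply is_rect_int_ext; [..|exact H3]; auto.
    intros z Hz. cbn [node_product]. rewrite Nat.add_0_l.
    assert (N1 : node_product t 0 n z <> 0).
    { apply node_product_neq_0. intros j Hj. apply (boundary_not_open_rect x1 x2 y1 y2); auto. apply Ht. lia. }
    field. repeat split; auto; apply Cminus_eq_contra, (boundary_not_open_rect x1 x2 y1 y2); auto. apply Ht. lia.
Qed.

End Interpolation.

Lemma newton_error (x1 x2 y1 y2 : R) f t n y (M r rho : R) : (x1 <= x2)%R -> (y1 <= y2)%R ->
  (forall z, in_rect x1 x2 y1 y2 z -> exists l, has_cderiv f z l) ->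
  (forall j, (j <= n)%nat -> open_rect x1 x2 y1 y2 (t j)) ->
  (forall i j, (i < j <= n)%nat -> t j <> t i) -> open_rect x1 x2 y1 y2 y ->
  (0 < r)%R -> (0 <= M)%R -> (0 <= rho)%R ->
  (forall z, on_boundary x1 x2 y1 y2 z -> (Cmod (f z) <= M)%R) ->
  (forall z, on_boundary x1 x2 y1 y2 z -> (r <= Cmod (z - y))%R) ->
  (forall z j, on_boundary x1 x2 y1 y2 z -> (j <= n)%nat -> (r <= Cmod (z - t j))%R) ->
  (forall j, (j <= n)%nat -> (Cmod (y - t j) <= rho)%R) ->
  (2 * PI * Cmod (f y - eval (newton t n y) f) <=
   2 * ((x2 - x1) + (y2 - y1)) * (M / r * (rho / r) ^ n))%R.
Proof.
  intros Hx Hy Hf Ht Hd Hyi Hr HM Hrho Hb Hzy Hzt Hyt.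
  assert (H := newton_remainder x1 x2 y1 y2 Hx Hy f Hf t n y Ht Hd Hyi n ltac:(lia)).
  apply (is_rect_int_bound _ _ _ _ _ _ (M / r * (rho / r) ^ n)%R) in H; auto.
  - rewrite !Cmod_mult, Cmod_Ci, !Cmod_R, Rmult_1_r in H.
    rewrite !Rabs_pos_eq in H by (assert (P := PI_RGT_0); lra). exact H.
  - intros z Hz. rewrite !Cmod_mult.
    assert (G : (r ^ n <= Cmod (node_product t 0 n z))%R).
    { apply node_product_ge; [lra|]. intros; apply Hzt; auto; lia. }
    assert (G' : (Cmod (node_product t 0 n y) <= rho ^ n)%R).
    { apply node_product_le. intros; apply Hyt; lia. }
    assert (rn : (0 < r ^ n)%R) by (apply pow_lt; auto).
    specialize (Hzy z Hz).
    rewrite Cmod_inv, Cmod_mult.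
    2:{ apply Cmult_neq_0; apply Cmod_gt_0; lra. }
    replace (M / r * (rho / r) ^ n)%R with (rho ^ n * (M * / (r ^ n * r)))%R.
    2:{ unfold Rdiv. rewrite Rpow_mult_distr, pow_inv. field. split; lra. }
    apply Rmult_le_compat; auto.
    + apply Cmod_ge_0.
    + apply Rmult_le_pos; [apply Cmod_ge_0|]. left. apply Rinv_0_lt_compat.
      apply Rmult_lt_0_compat; lra.
    + apply Rmult_le_compat; auto.
      * apply Cmod_ge_0.
      * left. apply Rinv_0_lt_compat. apply Rmult_lt_0_compat; lra.
      * apply Rinv_le_contravar; [apply Rmult_lt_0_compat; auto|]. apply Rmult_le_compat; lra.
Qed.

Lemma newton_supported t (S : C -> Prop) n y : (forall j, (j < n)%nat -> S (t j)) ->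
  supported (newton t n y) S.
Proof.
  induction n as [|n IH]; intros H; simpl.
  - intros c p [].
  - apply supported_app; [apply IH; intros; apply H; lia|].
    apply supported_scale, divided_diff_supported. intros; apply H; lia.
Qed.

Lemma newton_has_cderiv t n f z : exists l, has_cderiv (fun y => eval (newton t n y) f) z l.
Proof.
  induction n as [|n [l IH]].
  - exists 0. exact (has_cderiv_ext _ _ _ _ (fun y => eq_refl) (has_cderiv_const 0 z)).
  - destruct (node_product_has_cderiv t 0 n z) as [m Hm].
    eexists. refine (has_cderiv_ext _ _ _ _ _ (has_cderiv_plus _ _ _ _ _ IH
      (has_cderiv_mult _ _ _ _ _ Hm (has_cderiv_const (eval (divided_diff t 0 n) f) z)))).
    intros y. cbn [newton]. rewrite eval_app, eval_scale. reflexivity.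
Qed.

(** The [m]-th term is a product of [m] distances, each at most [rho], times a divided
    difference, so it is at most a term of the exponential series at [2 * rho / s]. *)
Lemma newton_l1_norm t (s : R) N y (rho : R) : (0 < s)%R -> (0 <= rho)%R ->
  (forall i j, (i < j <= N)%nat -> (s * INR (j - i) <= Cmod (t j - t i))%R) ->
  (forall j, (j <= N)%nat -> (Cmod (y - t j) <= rho)%R) ->
  forall n, (n <= N)%nat -> (l1_norm (newton t (S n) y) <= sum_f_R0 (fun m => (2 * rho / s) ^ m / INR (fact m)) n)%R.
Proof.
  intros Hs Hrho Ht Hy.
  assert (Term : forall m, (m <= N)%nat ->
     (l1_norm (scale (node_product t 0 m y) (divided_diff t 0 m)) <= (2 * rho / s) ^ m / INR (fact m))%R).
  { intros m Hm. rewrite l1_norm_scale.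
    replace (2 * rho / s)%R with (rho * (2 / s))%R by (field; lra).
    rewrite Rpow_mult_distr. unfold Rdiv at 1. rewrite Rmult_assoc.
    apply Rmult_le_compat; [apply Cmod_ge_0|apply l1_norm_pos| |].
    - apply node_product_le. intros; apply Hy; lia.
    - apply (divided_diff_l1_norm t s N); auto. }
  induction n as [|n IH]; intros Hn.
  - cbn [newton]. rewrite l1_norm_app. simpl sum_f_R0. specialize (Term 0%nat Hn).
    simpl l1_norm at 1. eapply Rle_trans; [|exact Term]. simpl. lra.
  - change (newton t (S (S n)) y) with (newton t (S n) y ++ scale (node_product t 0 (S n) y) (divided_diff t 0 (S n))).
    rewrite l1_norm_app. rewrite tech5. apply Rplus_le_compat; [apply IH; lia|apply Term; exact Hn].
Qed.

Lemma newton_l1_norm_exp t (s : R) N y (rho : R) n : (0 < s)%R -> (0 <= rho)%R ->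
  (forall i j, (i < j <= N)%nat -> (s * INR (j - i) <= Cmod (t j - t i))%R) ->
  (forall j, (j <= N)%nat -> (Cmod (y - t j) <= rho)%R) -> (n <= N)%nat ->
  (l1_norm (newton t n y) <= exp (2 * rho / s))%R.
Proof.
  intros Hs Hr Ht Hy Hn. destruct n as [|n].
  - left. apply exp_pos.
  - eapply Rle_trans; [apply (newton_l1_norm t s N y rho Hs Hr Ht Hy n); lia|].
    apply exp_ge_taylor. apply Rdiv_le_0_compat; lra.
Qed.

(** * Locally uniform limits of holomorphic functions *)

Lemma segment_bounded (g : C -> C) (p : R -> C) a b : (a <= b)%R ->
  (forall s t, Cmod (p s - p t) <= Rabs (s - t))%R ->
  (forall t, (a <= t <= b)%R -> ccontinuous g (p t)) ->
  exists M, forall t, (a <= t <= b)%R -> (Cmod (g (p t)) <= M)%R.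
Proof.
  intros Hab Hp Hg.
  destruct (continuity_ab_maj (fun t => Cmod (g (p t))) a b Hab) as [m [Hm _]].
  - intros t Ht e He. destruct (Hg t Ht e He) as [d [d0 Hd]].
    exists d. split; [exact d0|]. intros s [_ Hs]. simpl in *. unfold Rdist in *.
    eapply Rle_lt_trans; [|apply (Hd (p s)); eapply Rle_lt_trans; [apply Hp|exact Hs]].
    apply Rabs_le. assert (T1 := Cmod_triangle (g (p s) - g (p t)) (g (p t))).
    assert (T2 := Cmod_triangle (g (p s)) (- (g (p s) - g (p t)))).
    rewrite Cmod_opp in T2. replace (g (p s) - g (p t) + g (p t)) with (g (p s)) in T1 by ring.
    replace (g (p s) + - (g (p s) - g (p t))) with (g (p t)) in T2 by ring. lra.
  - exists (Cmod (g (p m))). exact Hm.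
Qed.

Lemma bounded_on_boundary g x1 x2 y1 y2 : (x1 <= x2)%R -> (y1 <= y2)%R ->
  (forall z, on_boundary x1 x2 y1 y2 z -> ccontinuous g z) ->
  exists M, forall z, on_boundary x1 x2 y1 y2 z -> (Cmod (g z) <= M)%R.
Proof.
  intros Hx Hy Hg.
  destruct (segment_bounded g (fun x => (x, y1)) x1 x2 Hx) as [M1 H1];
    [intros; right; apply Cmod_horizontal|intros; apply Hg; unfold on_boundary, in_rect; simpl; intuition lra|].
  destruct (segment_bounded g (fun x => (x, y2)) x1 x2 Hx) as [M2 H2];
    [intros; right; apply Cmod_horizontal|intros; apply Hg; unfold on_boundary, in_rect; simpl; intuition lra|].
  destruct (segment_bounded g (fun y => (x1, y)) y1 y2 Hy) as [M3 H3];
    [intros; right; apply Cmod_vertical|intros; apply Hg; unfold on_boundary, in_rect; simpl; intuition lra|].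
  destruct (segment_bounded g (fun y => (x2, y)) y1 y2 Hy) as [M4 H4];
    [intros; right; apply Cmod_vertical|intros; apply Hg; unfold on_boundary, in_rect; simpl; intuition lra|].
  exists (Rmax (Rmax M1 M2) (Rmax M3 M4)).
  assert (L1 := Rmax_l M1 M2). assert (L2 := Rmax_r M1 M2).
  assert (L3 := Rmax_l M3 M4). assert (L4 := Rmax_r M3 M4).
  assert (L5 := Rmax_l (Rmax M1 M2) (Rmax M3 M4)). assert (L6 := Rmax_r (Rmax M1 M2) (Rmax M3 M4)).
  intros [x y] [[Hx' Hy'] [E|[E|[E|E]]]]; simpl in *; subst.
  - specialize (H3 y Hy'). lra.
  - specialize (H4 y Hy'). lra.
  - specialize (H1 x Hx'). lra.
  - specialize (H2 x Hx'). lra.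
Qed.

Lemma im_le_Cmod (c : C) : (Rabs (Im c) <= Cmod c)%R.
Proof. eapply Rle_trans; [|apply Rmax_Cmod]. apply Rmax_r. Qed.

Lemma open_rect_gap x1 x2 y1 y2 a : open_rect x1 x2 y1 y2 a ->
  exists r, (0 < r)%R /\ (forall z, on_boundary x1 x2 y1 y2 z -> (r <= Cmod (z - a))%R) /\
    (forall y, (Cmod (y - a) < r)%R -> open_rect x1 x2 y1 y2 y).
Proof.
  destruct a as [p q]. intros [[Hp1 Hp2] [Hq1 Hq2]]. simpl in *.
  set (r := Rmin (Rmin (p - x1) (x2 - p)) (Rmin (q - y1) (y2 - q))).
  assert (L1 := Rmin_l (p - x1) (x2 - p)). assert (L2 := Rmin_r (p - x1) (x2 - p)).
  assert (L3 := Rmin_l (q - y1) (y2 - q)). assert (L4 := Rmin_r (q - y1) (y2 - q)).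
  assert (L5 : (r <= Rmin (p - x1) (x2 - p))%R) by apply Rmin_l.
  assert (L6 : (r <= Rmin (q - y1) (y2 - q))%R) by apply Rmin_r.
  exists r. split; [|split].
  - unfold r. repeat apply Rmin_pos; lra.
  - intros [x y] [_ Hz]. simpl in Hz.
    assert (A1 := re_le_Cmod ((x, y) - (p, q))). assert (A2 := im_le_Cmod ((x, y) - (p, q))).
    simpl in A1, A2.
    destruct Hz as [E|[E|[E|E]]]; subst.
    + rewrite Rabs_left1 in A1; lra.
    + rewrite Rabs_pos_eq in A1; lra.
    + rewrite Rabs_left1 in A2; lra.
    + rewrite Rabs_pos_eq in A2; lra.
  - intros [x y] H.
    assert (A1 := re_le_Cmod ((x, y) - (p, q))). assert (A2 := im_le_Cmod ((x, y) - (p, q))).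
    simpl in A1, A2. apply (fun h => Rle_lt_trans _ _ _ h H) in A1, A2.
    apply Rabs_def2 in A1, A2. unfold open_rect; simpl. lra.
Qed.

Lemma open_rect_le x1 x2 y1 y2 a : open_rect x1 x2 y1 y2 a -> (x1 <= x2)%R /\ (y1 <= y2)%R.
Proof. unfold open_rect. lra. Qed.

Lemma Cmod_2PI_Ci : Cmod (2 * PI * Ci) = (2 * PI)%R.
Proof.
  rewrite !Cmod_mult, Cmod_Ci, !Cmod_R, !Rabs_pos_eq by (assert (P := PI_RGT_0); lra). ring.
Qed.

Lemma C2PI_Ci_neq_0 : 2 * PI * Ci <> 0.
Proof. apply Cmod_gt_0. rewrite Cmod_2PI_Ci. assert (P := PI_RGT_0). lra. Qed.

(** The kernel [1 / (z - y)] expands to second order in [y] around [a], uniformly for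
    [z] on the boundary; integrating the expansion against [f] gives the derivative. *)
Lemma has_cderiv_of_Cauchy_formula f x1 x2 y1 y2 a : open_rect x1 x2 y1 y2 a ->
  (forall z, on_boundary x1 x2 y1 y2 z -> ccontinuous f z) ->
  (forall y, open_rect x1 x2 y1 y2 y ->
     is_rect_int (fun z => f z * / (z - y)) x1 x2 y1 y2 (2 * PI * Ci * f y)) ->
  exists l, has_cderiv f a l.
Proof.
  intros Ha Hc HC. destruct (open_rect_le _ _ _ _ _ Ha) as [Hx Hy].
  destruct (bounded_on_boundary f x1 x2 y1 y2 Hx Hy Hc) as [M HM].
  destruct (open_rect_gap _ _ _ _ _ Ha) as (r & r0 & Hr & Hry).
  assert (M0 : (0 <= M)%R).
  { eapply Rle_trans; [|apply (HM (x1, y1))]; [apply Cmod_ge_0|].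
    unfold on_boundary, in_rect; simpl. intuition lra. }
  assert (Hna : forall z, on_boundary x1 x2 y1 y2 z -> z - a <> 0).
  { intros z Hz. apply Cmod_gt_0. specialize (Hr z Hz). lra. }
  assert (HL : is_rect_int (fun z => f z * / ((z - a) * (z - a))) x1 x2 y1 y2
     (rect_int (fun z => f z * / ((z - a) * (z - a))) x1 x2 y1 y2)).
  { apply rect_int_correct; auto. intros z Hz. apply ccontinuous_mult; auto.
    apply (ccontinuous_inv (fun z => (z - a) * (z - a))).
    - apply Cmult_neq_0; auto.
    - apply ccontinuous_mult; apply ccontinuous_plus; apply ccontinuous_id || apply (ccontinuous_const (- a)). }
  set (L := rect_int _ _ _ _ _) in HL.
  exists (L * / (2 * PI * Ci)). intros e He.
  set (P := (2 * ((x2 - x1) + (y2 - y1)))%R). assert (P0 : (0 <= P)%R) by (unfold P; lra).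
  set (K := (P * (M * / (r * r * (r / 2))))%R).
  assert (r3 : (0 < r * r * (r / 2))%R) by (repeat apply Rmult_lt_0_compat; lra).
  assert (K0 : (0 <= K)%R).
  { unfold K. apply Rmult_le_pos; auto. apply Rmult_le_pos; auto. left. apply Rinv_0_lt_compat; auto. }
  exists (Rmin (r / 2) (e / (K + 1))). split.
  { apply Rmin_pos; [lra|apply Rdiv_lt_0_compat; lra]. }
  intros y Hya.
  assert (Hy1 := Rlt_le_trans _ _ _ Hya (Rmin_l _ _)). assert (Hy2 := Rlt_le_trans _ _ _ Hya (Rmin_r _ _)).
  assert (Hyi : open_rect x1 x2 y1 y2 y) by (apply Hry; lra).
  assert (Hzy : forall z, on_boundary x1 x2 y1 y2 z -> (r / 2 <= Cmod (z - y))%R).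
  { intros z Hz. specialize (Hr z Hz). assert (T := Cmod_triangle (z - y) (y - a)).
    replace (z - y + (y - a)) with (z - a) in T by ring. lra. }
  assert (H3 := is_rect_int_plus _ _ _ _ _ _ _ _ (HC y Hyi)
    (is_rect_int_plus _ _ _ _ _ _ _ _ (is_rect_int_scal (- (1)) _ _ _ _ _ _ (HC a Ha))
      (is_rect_int_scal (- (y - a)) _ _ _ _ _ _ HL))).
  apply (is_rect_int_ext _ (fun z => (y - a) * (y - a) * (f z * / ((z - a) * (z - a) * (z - y))))) in H3; auto.
  2:{ intros z Hz. assert (N := Hna z Hz). assert (N' : z - y <> 0).
      { apply Cmod_gt_0. specialize (Hzy z Hz). lra. } field. auto. }
  apply (is_rect_int_bound _ _ _ _ _ _ (Cmod (y - a) * Cmod (y - a) * (M * / (r * r * (r / 2))))%R) in H3; auto.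
  - replace (2 * PI * Ci * f y + (- (1) * (2 * PI * Ci * f a) + - (y - a) * L))
      with ((2 * PI * Ci) * (f y - f a - L * / (2 * PI * Ci) * (y - a))) in H3
      by (field; intuition (apply C2PI_Ci_neq_0; assumption || (rewrite H; ring) || idtac)).
    rewrite Cmod_mult, Cmod_2PI_Ci in H3. fold P in H3.
    assert (PI1 : (1 <= 2 * PI)%R) by (assert (Q := PI2_1); unfold Rdiv in Q; lra).
    set (W := Cmod (f y - _ - _)) in *. assert (W0 : (0 <= W)%R) by apply Cmod_ge_0.
    set (D := Cmod (y - a)) in *. assert (D0 : (0 <= D)%R) by apply Cmod_ge_0.
    replace (P * (D * D * (M * / (r * r * (r / 2)))))%R with (K * D * D)%R in H3 by (unfold K; ring).
    apply Rle_trans with (K * D * D)%R; [nra|].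
    apply Rmult_le_compat_r; auto.
    apply Rle_trans with ((K + 1) * D)%R; [nra|].
    apply Rlt_le in Hy2. apply (Rmult_le_compat_l (K + 1)) in Hy2; [|lra].
    replace ((K + 1) * (e / (K + 1)))%R with e in Hy2 by (field; lra). exact Hy2.
  - intros z Hz. specialize (Hr z Hz). specialize (Hzy z Hz). rewrite !Cmod_mult.
    apply Rmult_le_compat_l. { apply Rmult_le_pos; apply Cmod_ge_0. }
    rewrite Cmod_inv, !Cmod_mult.
    2:{ repeat apply Cmult_neq_0; apply Cmod_gt_0; lra. }
    apply Rmult_le_compat; auto; [apply Cmod_ge_0| |].
    + left. apply Rinv_0_lt_compat. repeat apply Rmult_lt_0_compat; lra.
    + apply Rinv_le_contravar; auto.
      apply Rmult_le_compat; try nra. 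
Qed.

(** Cauchy's formula passes to a uniform limit, and a continuous function that
    satisfies it is differentiable. *)
Theorem Weierstrass (A : nat -> C -> C) f a eta (eps : nat -> R) : (0 < eta)%R ->
  (forall n z, (Cmod (z - a) < eta)%R -> exists l, has_cderiv (A n) z l) ->
  (forall n z, (Cmod (z - a) < eta)%R -> (Cmod (f z - A n z) <= eps n)%R) ->
  (forall e, (0 < e)%R -> exists n, (eps n < e)%R) ->
  exists l, has_cderiv f a l.
Proof.
  intros Heta HA Hu Heps.
  assert (Hc : forall z, (Cmod (z - a) < eta)%R -> ccontinuous f z).
  { intros z Hz e He. destruct (Heps (e / 3)%R ltac:(lra)) as [n Hn].
    destruct (HA n z Hz) as [l Hl]. apply has_cderiv_ccontinuous in Hl.
    destruct (Hl (e / 3)%R ltac:(lra)) as [d [d0 Hd]].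
    exists (Rmin d (eta - Cmod (z - a))). split; [apply Rmin_pos; lra|]. intros y Hy.
    assert (Hy1 := Rlt_le_trans _ _ _ Hy (Rmin_l _ _)). assert (Hy2 := Rlt_le_trans _ _ _ Hy (Rmin_r _ _)).
    assert (Hya : (Cmod (y - a) < eta)%R).
    { assert (T := Cmod_triangle (y - z) (z - a)). replace (y - z + (z - a)) with (y - a) in T by ring. lra. }
    specialize (Hd y Hy1). assert (U1 := Hu n y Hya). assert (U2 := Hu n z Hz).
    replace (f y - f z) with ((f y - A n y) + ((A n y - A n z) + - (f z - A n z))) by ring.
    eapply Rle_lt_trans; [apply Cmod_triangle|].
    assert (T := Cmod_triangle (A n y - A n z) (- (f z - A n z))). rewrite Cmod_opp in T. lra. }
  set (h := (eta / 3)%R).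
  set (x1 := (Re a - h)%R). set (x2 := (Re a + h)%R). set (y1 := (Im a - h)%R). set (y2 := (Im a + h)%R).
  assert (Hin : forall z, in_rect x1 x2 y1 y2 z -> (Cmod (z - a) < eta)%R).
  { intros z [Hz1 Hz2]. eapply Rle_lt_trans; [apply Cmod_le_Re_Im|].
    apply Rle_lt_trans with (h + h)%R; [|unfold h; lra].
    unfold x1, x2, y1, y2 in *. clear - Hz1 Hz2. destruct z as [u v], a as [p q]. simpl in *.
    apply Rplus_le_compat; apply Rabs_le; lra. }
  assert (Ha : open_rect x1 x2 y1 y2 a).
  { unfold open_rect, x1, x2, y1, y2, h. lra. }
  destruct (open_rect_le _ _ _ _ _ Ha) as [Hx Hy].
  apply (has_cderiv_of_Cauchy_formula f x1 x2 y1 y2 a Ha).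
  { intros z [Hz _]. auto. }
  intros y Hyi. destruct (open_rect_gap _ _ _ _ _ Hyi) as (r & r0 & Hr & _).
  assert (Hny : forall z, on_boundary x1 x2 y1 y2 z -> z - y <> 0).
  { intros z Hz. apply Cmod_gt_0. specialize (Hr z Hz). lra. }
  assert (HI : is_rect_int (fun z => f z * / (z - y)) x1 x2 y1 y2 (rect_int (fun z => f z * / (z - y)) x1 x2 y1 y2)).
  { apply rect_int_correct; auto. intros z Hz. apply ccontinuous_mult; [apply Hc, Hin, Hz|].
    apply (ccontinuous_inv (fun z => z - y)); auto.
    apply ccontinuous_plus; apply ccontinuous_id || apply (ccontinuous_const (- y)). }
  set (I := rect_int _ _ _ _ _) in HI.
  replace (2 * PI * Ci * f y) with I; [exact HI|].
  apply Ceq_minus, Cmod_eq_0, Rle_antisym; [|apply Cmod_ge_0].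
  apply le_epsilon. intros e He. rewrite Rplus_0_l.
  set (P := (2 * ((x2 - x1) + (y2 - y1)))%R). assert (P0 : (0 <= P)%R) by (unfold P; lra).
  assert (PI0 := PI_RGT_0).
  assert (Q0 : (0 < P / r + 2 * PI)%R).
  { assert (0 <= P / r)%R by (apply Rdiv_le_0_compat; lra). lra. }
  destruct (Heps (e / (P / r + 2 * PI))%R ltac:(apply Rdiv_lt_0_compat; lra)) as [n Hn].
  assert (HAn := Cauchy_is_rect_int x1 x2 y1 y2 Hx Hy (A n) (fun z Hz => HA n z (Hin z Hz)) y Hyi).
  assert (H3 := is_rect_int_plus _ _ _ _ _ _ _ _ HI (is_rect_int_scal (- (1)) _ _ _ _ _ _ HAn)).
  apply (is_rect_int_ext _ (fun z => (f z - A n z) * / (z - y))) in H3; auto.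
  2:{ intros z Hz. ring. }
  apply (is_rect_int_bound _ _ _ _ _ _ (eps n * / r)%R) in H3; auto.
  - fold P in H3.
    assert (U := Hu n y ltac:(apply Hin; unfold in_rect, open_rect in *; lra)).
    replace (I - 2 * PI * Ci * f y) with ((I + - (1) * (2 * PI * Ci * A n y)) + - (2 * PI * Ci * (f y - A n y))) by ring.
    eapply Rle_trans; [apply Cmod_triangle|]. rewrite Cmod_opp, (Cmod_mult (2 * PI * Ci)), Cmod_2PI_Ci.
    apply Rle_trans with (eps n * (P / r + 2 * PI))%R.
    + replace (eps n * (P / r + 2 * PI))%R with (P * (eps n * / r) + 2 * PI * eps n)%R by (field; lra).
      apply Rplus_le_compat; [exact H3|]. apply Rmult_le_compat_l; lra.
    + apply Rlt_le in Hn. apply (Rmult_le_compat_r (P / r + 2 * PI)) in Hn; [|lra].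
      replace (e / (P / r + 2 * PI) * (P / r + 2 * PI))%R with e in Hn
        by (revert Q0; generalize (P / r + 2 * PI)%R; intros Q Q0; field; lra). exact Hn.
  - intros z Hz. specialize (Hr z Hz). rewrite Cmod_mult, Cmod_inv by auto.
    apply Rmult_le_compat; try apply Cmod_ge_0.
    + left. apply Rinv_0_lt_compat. lra.
    + apply Hu, Hin, Hz.
    + apply Rinv_le_contravar; lra.
Qed.

(** * Positive definite kernels *)

Lemma sum_n_m_list {T : Type} (F : T -> C) (d : T) (l : list T) :
  sum_n_m (G := C_AbelianMonoid) (fun i => F (nth (i - 1) l d)) 1 (length l) =
  fold_right (fun x s => F x + s) 0 l.
Proof.
  induction l as [|a l IH]; simpl length.
  - rewrite sum_n_m_zero by lia. reflexivity.
  - rewrite sum_Sn_m by lia. cbn [fold_right]. rewrite <- IH.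
    change (plus ?a ?b) with (Cplus a b). f_equal.
    rewrite <- sum_n_m_S. apply sum_n_m_ext_loc. intros i Hi.
    destruct i as [|i]; [lia|]. simpl. rewrite Nat.sub_0_r. reflexivity.
Qed.

Lemma eval_fold l f : eval l f = fold_right (fun x s => fst x * f (snd x) + s) 0 l.
Proof. induction l as [|[c p] l IH]; simpl; congruence. Qed.

Lemma eval_ext l f g : supported l (fun p => f p = g p) -> eval l f = eval l g.
Proof.
  induction l as [|[c p] l IH]; intros H; simpl; [reflexivity|].
  rewrite (H c p) by (left; reflexivity). rewrite IH; [reflexivity|].
  intros c' p' H'. apply (H c'). right. exact H'.
Qed.

(** The squared norm, in the reproducing kernel space, of the combination [l] of
    kernel sections. *)
Definition gram (k : C * C -> C) (l : combination) : C :=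
  eval l (fun p => Cconj (eval l (fun q => Cconj (k (p, q))))).

Lemma gram_nonneg Omega k l : positive_definite_kernel Omega k -> supported l Omega -> Cnonneg (gram k l).
Proof.
  intros [_ Hk] Hl.
  set (d := (RtoC 0, RtoC 0)).
  assert (H := Hk (length l) (fun j => snd (nth (j - 1) l d)) (fun j => fst (nth (j - 1) l d))).
  replace (gram k l) with (sum_n_m (G := C_AbelianMonoid)
      (fun i => sum_n_m (G := C_AbelianMonoid)
        (fun j => (k (snd (nth (i - 1) l d), snd (nth (j - 1) l d)) * fst (nth (i - 1) l d) * Cconj (fst (nth (j - 1) l d)))%C) 1 (length l)) 1 (length l)).
  - apply H. intros j Hj. assert (I := nth_In l d (n := j - 1) ltac:(lia)).
    destruct (nth (j - 1) l d) as [c p]. exact (Hl c p I).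
  - assert (E1 : forall x : C * C, sum_n_m (G := C_AbelianMonoid) (fun j => k (snd x, snd (nth (j - 1) l d)) * fst x * Cconj (fst (nth (j - 1) l d))) 1 (length l)
       = fst x * Cconj (eval l (fun q => Cconj (k (snd x, q))))).
    { intros x. rewrite (sum_n_m_list (fun y => k (snd x, snd y) * fst x * Cconj (fst y)) d l).
      clear. induction l as [|[c p] l IH]; simpl.
      - replace (Cconj 0) with (RtoC 0); [ring|]. unfold Cconj, RtoC; simpl. f_equal. ring.
      - rewrite IH, Cplus_conj, Cmult_conj, Cconj_conj. ring. }
    rewrite (sum_n_m_ext _ _ _ _ (fun i => E1 (nth (i - 1) l d))).
    rewrite (sum_n_m_list (fun y => fst y * Cconj (eval l (fun q => Cconj (k (snd y, q))))) d l).
    unfold gram. rewrite (eval_fold l (fun p => _)). reflexivity.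
Qed.

(** The diagonal entries and the values at the coefficient vectors [(1, 1)] and
    [(1, i)] of a two-point Gram matrix are real, which determines both parts. *)
Lemma kernel_hermitian Omega k u v : positive_definite_kernel Omega k -> Omega u -> Omega v ->
  k (u, v) = Cconj (k (v, u)).
Proof.
  intros Hk Hu Hv.
  assert (S : forall c d, supported [(c, u); (d, v)] Omega).
  { intros c d a p [E|[E|[]]]; injection E as <- <-; assumption. }
  destruct (gram_nonneg Omega k [(RtoC 0, u); (RtoC 1, v)] Hk (S _ _)) as [_ Hvv].
  destruct (gram_nonneg Omega k [(RtoC 1, u); (RtoC 0, v)] Hk (S _ _)) as [_ Huu].
  destruct (gram_nonneg Omega k [(RtoC 1, u); (RtoC 1, v)] Hk (S _ _)) as [_ H1].
  destruct (gram_nonneg Omega k [(RtoC 1, u); (Ci, v)] Hk (S _ _)) as [_ H2].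
  unfold gram in *; simpl in *.
  destruct (k (u, u)) as [a1 a2], (k (u, v)) as [b1 b2], (k (v, u)) as [c1 c2], (k (v, v)) as [d1 d2].
  simpl in *. unfold Cconj; simpl. f_equal; lra.
Qed.

Lemma mult_conj_Cmod (E : C) : E * Cconj E = RtoC (Cmod E ^ 2).
Proof. symmetry. apply Cmod2_conj. Qed.

(** Expand the nonnegative squared norm of [l] minus [s] times the value [E] at [w]
    times the section at [w]. The factor [Cmod (k (w, w)) + 1] instead of [k (w, w)]
    allows the single choice [s = 1 / (Cmod (k (w, w)) + 1)], whether or not
    [k (w, w)] vanishes. *)
Lemma kernel_Cauchy_Schwarz Omega k l w : positive_definite_kernel Omega k ->
  supported l Omega -> Omega w ->
  (Cmod (eval l (fun q => k (q, w))) ^ 2 <= (Cmod (k (w, w)) + 1) * Cmod (gram k l))%R.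
Proof.
  intros Hk Hl Hw. set (E := eval l (fun q => k (q, w))).
  set (kap := Cmod (k (w, w))). assert (K0 : (0 <= kap)%R) by apply Cmod_ge_0.
  set (s := (/ (kap + 1))%R).
  destruct (gram_nonneg Omega k (l ++ [(- RtoC s * E, w)]) Hk) as [H _].
  { apply supported_app; auto. intros c p [I|[]]. injection I as <- <-. exact Hw. }
  assert (EE : eval l (fun q => Cconj (k (w, q))) = E).
  { apply eval_ext. intros c p I. rewrite (kernel_hermitian Omega k w p), Cconj_conj; eauto. }
  assert (X : gram k (l ++ [(- RtoC s * E, w)]) =
     gram k l - 2 * s * (E * Cconj E) + s * s * (E * Cconj E) * k (w, w)).
  { unfold gram. rewrite eval_app. cbn [eval]. rewrite eval_app. cbn [eval]. rewrite EE.
    rewrite (eval_ext l _ (fun p => Cconj (eval l (fun q => Cconj (k (p, q)))) + Cconj (- RtoC s * E) * k (p, w))).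
    2:{ intros c p I. rewrite eval_app. cbn [eval]. rewrite !Cplus_conj, !Cmult_conj, !Cconj_conj.
        replace (Cconj 0) with (RtoC 0) by (unfold Cconj, RtoC; simpl; f_equal; ring). ring. }
    assert (L : forall f b, eval l (fun p => f p + b * k (p, w)) = eval l f + b * E).
    { intros f b. unfold E. clear. induction l as [|[c p] l IH]; simpl; [ring|]. rewrite IH. ring. }
    rewrite L, !Cplus_conj, !Cmult_conj, !Cconj_conj, !Copp_conj.
    replace (Cconj s) with (RtoC s) by (unfold Cconj, RtoC; simpl; f_equal; ring).
    replace (Cconj 0) with (RtoC 0) by (unfold Cconj, RtoC; simpl; f_equal; ring). ring. }
  rewrite X, mult_conj_Cmod in H.
  assert (R1 : (Re (gram k l) <= Cmod (gram k l))%R).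
  { eapply Rle_trans; [apply Rle_abs|apply re_le_Cmod]. }
  assert (R2 : (Re (k (w, w)) <= kap)%R).
  { eapply Rle_trans; [apply Rle_abs|apply re_le_Cmod]. }
  set (e2 := (Cmod E ^ 2)%R) in *. assert (E0 : (0 <= e2)%R) by apply pow2_ge_0. clearbody e2.
  assert (H' : (0 <= Re (gram k l) - 2 * s * e2 + s * s * e2 * Re (k (w, w)))%R).
  { revert H. destruct (gram k l), (k (w, w)). simpl. intros H. ring_simplify in H. ring_simplify. exact H. }
  assert (s0 : (0 < s)%R) by (unfold s; apply Rinv_0_lt_compat; lra).
  assert (sk : (s * (kap + 1) = 1)%R) by (unfold s; field; lra).
  assert (H2 : (s * s * e2 * Re (k (w, w)) <= s * e2)%R).
  { apply Rle_trans with (s * s * e2 * kap)%R.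
    - apply Rmult_le_compat_l; auto. repeat apply Rmult_le_pos; lra.
    - replace (s * s * e2 * kap)%R with (s * e2 * (s * kap))%R by ring.
      rewrite <- (Rmult_1_r (s * e2)) at 2. apply Rmult_le_compat_l; [apply Rmult_le_pos; lra|]. lra. }
  assert (H3 : (s * e2 <= Cmod (gram k l))%R) by lra.
  apply (Rmult_le_compat_l (kap + 1)) in H3; [|lra].
  replace ((kap + 1) * (s * e2))%R with (s * (kap + 1) * e2)%R in H3 by ring.
  rewrite sk in H3. lra.
Qed.

(** The Gram value of [l] is itself a combination, with the conjugate coefficients, of
    the values of [l] against its own points. So a combination that is small against
    its own points is small against every point [w], wherever [w] lies. *)
Lemma kernel_node_control Omega k l w e : positive_definite_kernel Omega k ->
  supported l Omega -> Omega w ->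
  supported l (fun p => (Cmod (eval l (fun q => k (q, p))) <= e)%R) ->
  (Cmod (eval l (fun q => k (q, w))) ^ 2 <= (Cmod (k (w, w)) + 1) * (l1_norm l * e))%R.
Proof.
  intros Hk Hl Hw He.
  eapply Rle_trans; [apply (kernel_Cauchy_Schwarz Omega); eauto|].
  apply Rmult_le_compat_l. { assert (H := Cmod_ge_0 (k (w, w))). lra. }
  apply eval_bound. intros c p I. rewrite Cmod_conj.
  rewrite (eval_ext l _ (fun q => k (q, p))).
  - exact (He c p I).
  - intros c' q I'. rewrite (kernel_hermitian Omega k p q), Cconj_conj; eauto.
Qed.

(** * Holomorphy of the kernel sections at a point *)

Lemma exp_mult_INR x n : exp (x * INR n) = (exp x ^ n)%R.
Proof.
  induction n as [|n IH].
  - simpl. rewrite Rmult_0_r. apply exp_0.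
  - rewrite S_INR, Rmult_plus_distr_l, exp_plus, IH, Rmult_1_r. simpl. ring.
Qed.

(** The pointwise rate [K'] may depend on anything, but it disappears from the
    conclusion: this turns pointwise convergence with uniform increments into uniform
    convergence. *)
Lemma geometric_tail (a : nat -> C) (l : C) (K K' : R) : (0 <= K)%R -> (0 <= K')%R ->
  (forall n, (Cmod (a (S n) - a n) <= K * (1 / 2) ^ n)%R) ->
  (forall n, (Cmod (l - a n) <= K' * (1 / 2) ^ n)%R) ->
  forall n, (Cmod (l - a n) <= 2 * K * (1 / 2) ^ n)%R.
Proof.
  intros HK HK' Hinc Hl n.
  assert (H : forall m, (Cmod (a (n + m)%nat - a n) <= 2 * K * (1 / 2) ^ n * (1 - (1 / 2) ^ m))%R).
  { induction m as [|m IH].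
    - rewrite Nat.add_0_r. replace (a n - a n) with (RtoC 0) by ring. rewrite Cmod_0. simpl. lra.
    - rewrite Nat.add_succ_r. specialize (Hinc (n + m)%nat). rewrite pow_add in Hinc.
      replace (a (S (n + m)) - a n) with ((a (S (n + m)) - a (n + m)%nat) + (a (n + m)%nat - a n)) by ring.
      eapply Rle_trans; [apply Cmod_triangle|]. change ((1 / 2) ^ S m)%R with (1 / 2 * (1 / 2) ^ m)%R. lra. }
  apply le_epsilon. intros e He.
  destruct (pow_lt_1_zero (1 / 2) ltac:(rewrite Rabs_pos_eq; lra) (e / (K' + 1)) ltac:(apply Rdiv_lt_0_compat; lra)) as [m Hm].
  specialize (Hm m (Nat.le_refl m)). rewrite Rabs_pos_eq in Hm by (apply pow_le; lra).
  specialize (Hl (n + m)%nat). specialize (H m).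
  replace (l - a n) with ((l - a (n + m)%nat) + (a (n + m)%nat - a n)) by ring.
  eapply Rle_trans; [apply Cmod_triangle|].
  assert (P1 : (0 <= (1 / 2) ^ n <= 1)%R).
  { split; [apply pow_le; lra|]. rewrite <- (pow1 n) at 2. apply pow_incr. lra. }
  assert (P2 : (0 <= (1 / 2) ^ m)%R) by (apply pow_le; lra).
  rewrite pow_add in Hl.
  assert (Hm' : (K' * (1 / 2) ^ m <= e)%R).
  { apply Rlt_le in Hm. apply (Rmult_le_compat_l (K' + 1)) in Hm; [|lra].
    replace ((K' + 1) * (e / (K' + 1)))%R with e in Hm by (field; lra). lra. }
  assert (H1 : (K' * ((1 / 2) ^ n * (1 / 2) ^ m) <= K' * (1 / 2) ^ m)%R).
  { apply Rmult_le_compat_l; auto. nra. }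
  assert (H2 : (0 <= 2 * K * (1 / 2) ^ n * (1 / 2) ^ m)%R).
  { repeat apply Rmult_le_pos; try lra; auto; apply P1. }
  lra.
Qed.

Lemma le_of_sq_le_geometric (x K : R) n : (0 <= K)%R -> (x ^ 2 <= K * (1 / 4) ^ n)%R ->
  (x <= sqrt K * (1 / 2) ^ n)%R.
Proof.
  intros HK H.
  assert (P : (0 <= (1 / 2) ^ n)%R) by (apply pow_le; lra).
  assert (S := sqrt_pos K).
  apply Rnot_lt_le. intros L.
  assert (0 <= sqrt K * (1 / 2) ^ n)%R by (apply Rmult_le_pos; auto).
  assert (E : ((sqrt K * (1 / 2) ^ n) ^ 2 = K * (1 / 4) ^ n)%R).
  { rewrite Rpow_mult_distr, pow2_sqrt, <- pow_mult, Nat.mul_comm, pow_mult by auto.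
    do 2 f_equal. simpl. field. }
  assert ((sqrt K * (1 / 2) ^ n) ^ 2 < x ^ 2)%R by (simpl; nra). lra.
Qed.

Lemma spaced_sum (tau : nat -> R) (h : R) N : (forall i, (i < N)%nat -> (tau i + h <= tau (S i))%R) ->
  forall i j, (i <= j <= N)%nat -> (h * INR (j - i) <= tau j - tau i)%R.
Proof.
  intros H i j. induction j as [|j IH]; intros Hij.
  - replace i with 0%nat by lia. simpl. lra.
  - destruct (Nat.eq_dec i (S j)) as [->|E].
    + rewrite Nat.sub_diag. simpl. lra.
    + assert (IH' := IH ltac:(lia)). assert (Hj := H j ltac:(lia)).
      replace (S j - i)%nat with (S (j - i)) by lia. rewrite S_INR. lra.
Qed.

Section Local.

Context (Omega : C -> Prop) (k : C * C -> C) (Hk : positive_definite_kernel Omega k)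
  (z0 : C) (R0 : R) (HR0 : (0 < R0)%R).
Let nbhd := open_rect (Re z0 - R0) (Re z0 + R0) (Im z0 - R0) (Im z0 + R0).

Context (HD : forall v, nbhd v -> Omega v)
  (Hdiff : forall u v, nbhd u -> nbhd v -> exists l, has_cderiv (fun x => k (x, v)) u l).
Let delta := (R0 / 2)%R.

(* Interpolation at [N] points has coefficients of size [exp (8 N)] and error
   [ratio ^ N]; this choice makes [exp 8 * ratio = 1 / 4]. *)
Let eta := (delta / (1 + 8 * exp 8))%R.
Let gap := (delta - eta)%R.
Let x1 := (Re z0 - delta)%R.
Let x2 := (Re z0 + delta)%R.
Let y1 := (Im z0 - delta)%R.
Let y2 := (Im z0 + delta)%R.
Let ratio := (2 * eta / gap)%R.

Lemma exp8_pos : (0 < exp 8)%R.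
Proof. apply exp_pos. Qed.

Lemma eta_pos : (0 < eta)%R.
Proof. unfold eta, delta. assert (E := exp8_pos). apply Rdiv_lt_0_compat; lra. Qed.

Lemma gap_eq : (gap = 8 * exp 8 * eta)%R.
Proof. unfold gap, eta. assert (E := exp8_pos). field. lra. Qed.

Lemma gap_pos : (0 < gap)%R.
Proof. rewrite gap_eq. assert (E := exp8_pos). assert (H := eta_pos). apply Rmult_lt_0_compat; [lra|exact H]. Qed.

Lemma ratio_eq : (exp 8 * ratio = 1 / 4)%R.
Proof. unfold ratio. rewrite gap_eq. assert (E := exp8_pos). assert (H := eta_pos). field. lra. Qed.

Lemma ratio_pos : (0 < ratio)%R.
Proof. unfold ratio. assert (H := eta_pos). apply Rdiv_lt_0_compat; [lra|apply gap_pos]. Qed.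

Lemma near_open_rect v : (Cmod (v - z0) <= eta)%R -> open_rect x1 x2 y1 y2 v.
Proof.
  intros H. assert (P := gap_pos). unfold gap in P.
  assert (A1 := re_le_Cmod (v - z0)). assert (A2 := im_le_Cmod (v - z0)).
  destruct v as [v1 v2], z0 as [p1 p2]. unfold open_rect, x1, x2, y1, y2. simpl in *.
  assert (B1 : (Rabs (v1 + - p1) < delta)%R) by lra. assert (B2 : (Rabs (v2 + - p2) < delta)%R) by lra.
  apply Rabs_def2 in B1, B2. lra.
Qed.

Lemma rect_nbhd v : in_rect x1 x2 y1 y2 v -> nbhd v.
Proof.
  unfold in_rect, x1, x2, y1, y2, nbhd, open_rect, delta. lra.
Qed.

Lemma near_nbhd v : (Cmod (v - z0) <= eta)%R -> nbhd v.
Proof. intros H. apply rect_nbhd. apply near_open_rect in H. unfold open_rect, in_rect in *. lra. Qed.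

Lemma boundary_far u v : on_boundary x1 x2 y1 y2 u -> (Cmod (v - z0) <= eta)%R -> (gap <= Cmod (u - v))%R.
Proof.
  intros [_ Hu] Hv.
  assert (Hd : (delta <= Cmod (u - z0))%R).
  { assert (A1 := re_le_Cmod (u - z0)). assert (A2 := im_le_Cmod (u - z0)).
    assert (P : (0 < delta)%R) by (unfold delta; lra).
    unfold x1, x2, y1, y2 in Hu. clear Hv. destruct u as [u1 u2], z0 as [p1 p2]. simpl in *.
    destruct Hu as [->|[->|[->| ->]]].
    - rewrite Rabs_left1 in A1; lra.
    - rewrite Rabs_pos_eq in A1; lra.
    - rewrite Rabs_left1 in A2; lra.
    - rewrite Rabs_pos_eq in A2; lra. }
  assert (T := Cmod_triangle (u - v) (v - z0)).
  replace (u - v + (v - z0)) with (u - z0) in T by ring. unfold gap. lra.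
Qed.

Lemma rect_ne : (x1 <= x2)%R /\ (y1 <= y2)%R.
Proof. unfold x1, x2, y1, y2, delta. lra. Qed.

(** [bounded_by M v] says that Cauchy's estimates on the contour apply to the section
    at [v] with the constant [M]. *)
Definition bounded_by (M : R) (v : C) : Prop := forall u, on_boundary x1 x2 y1 y2 u -> (Cmod (k (u, v)) <= M)%R.

Lemma bounded_by_exists v : nbhd v -> exists M, (0 <= M)%R /\ bounded_by M v.
Proof.
  intros Hv. destruct rect_ne as [Hx Hy].
  destruct (bounded_on_boundary (fun u => k (u, v)) x1 x2 y1 y2 Hx Hy) as [M HM].
  - intros u [Hu _]. destruct (Hdiff u v (rect_nbhd u Hu) Hv) as [l Hl]. exact (has_cderiv_ccontinuous _ _ _ Hl).
  - exists (Rmax 0 M). split; [apply Rmax_l|]. intros u Hu.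
    eapply Rle_trans; [exact (HM u Hu)|apply Rmax_r].
Qed.

Lemma ccontinuous_snd u v : nbhd u -> nbhd v -> ccontinuous (fun y => k (u, y)) v.
Proof.
  intros Hu Hv e He. destruct (Hdiff v u Hv Hu) as [l Hl]. apply has_cderiv_ccontinuous in Hl.
  destruct (Hl e He) as [d [d0 Hd]].
  destruct (open_rect_gap _ _ _ _ _ Hv) as (g & g0 & _ & Hg).
  exists (Rmin d g). split; [apply Rmin_pos; auto|]. intros y Hy.
  assert (Hy1 := Rlt_le_trans _ _ _ Hy (Rmin_l _ _)).
  assert (HyD : nbhd y) by exact (Hg y (Rlt_le_trans _ _ _ Hy (Rmin_r _ _))).
  rewrite (kernel_hermitian Omega k u y), (kernel_hermitian Omega k u v) by auto.
  rewrite <- Cminus_conj, Cmod_conj. auto.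
Qed.

Definition point (tau : R) : C := z0 + RtoC (eta * tau).

Lemma point_dist s t : Cmod (point s - point t) = (eta * Rabs (s - t))%R.
Proof.
  unfold point. replace (z0 + RtoC (eta * s) - (z0 + RtoC (eta * t))) with (RtoC (eta * (s - t))).
  - rewrite Cmod_R, Rabs_mult, (Rabs_pos_eq eta); [reflexivity|]. left. apply eta_pos.
  - rewrite !RtoC_mult, RtoC_minus. ring.
Qed.

Lemma point_near t : (0 <= t <= 1)%R -> (Cmod (point t - z0) <= eta)%R.
Proof.
  intros Ht. replace (point t - z0) with (RtoC (eta * t)) by (unfold point; ring).
  assert (H := eta_pos). rewrite Cmod_R, Rabs_pos_eq; nra.
Qed.

(** The sets of parameters whose section is bounded by [m] on the contour are closed,
    since [k] is continuous in its second variable near [z0], and they exhaust the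
    segment, since each single section is bounded on the contour. *)
Lemma nodes_exist : exists M, (0 <= M)%R /\ forall N, exists tau : nat -> R,
  (forall i, (i <= N)%nat -> bounded_by M (point (tau i)) /\ (0 <= tau i <= 1)%R) /\
  (forall i, (i < N)%nat -> (tau i + / (2 * INR (S N)) <= tau (S i))%R).
Proof.
  destruct (SpacedPoints.exhaustion_spaced_points_R
    (F := fun m tau => (0 <= tau <= 1)%R /\ bounded_by (INR m) (point tau))) as [m Hm].
  - intros m x Hx. destruct (Rlt_dec x 0) as [L|L]; [|destruct (Rlt_dec 1 x) as [L'|L']].
    + exists (- x)%R. split; [lra|]. intros y Hy [Hy' _]. apply Rabs_def2 in Hy. lra.
    + exists (x - 1)%R. split; [lra|]. intros y Hy [Hy' _]. apply Rabs_def2 in Hy. lra.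
    + assert (Hx' : exists u, on_boundary x1 x2 y1 y2 u /\ (INR m < Cmod (k (u, point x)))%R).
      { apply Classical_Prop.NNPP. intros H. apply Hx. split; [lra|]. intros u Hu.
        apply Rnot_lt_le. intros H'. apply H. exists u; auto. }
      destruct Hx' as (u & Hu & Hux).
      assert (HDx : nbhd (point x)) by (apply near_nbhd, point_near; lra).
      destruct (ccontinuous_snd u (point x) (rect_nbhd u (proj1 Hu)) HDx (Cmod (k (u, point x)) - INR m)%R ltac:(lra)) as [d [d0 Hd]].
      assert (E0 := eta_pos).
      exists (d / eta)%R. split; [apply Rdiv_lt_0_compat; auto|]. intros y Hy [_ Hb].
      specialize (Hb u Hu). specialize (Hd (point y)). rewrite point_dist in Hd.
      assert (Hlt : (eta * Rabs (y - x) < d)%R).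
      { apply (Rmult_lt_compat_l eta) in Hy; auto. replace (eta * (d / eta))%R with d in Hy by (field; lra). exact Hy. }
      specialize (Hd Hlt).
      assert (T := Cmod_triangle (k (u, point y)) (- (k (u, point y) - k (u, point x)))).
      rewrite Cmod_opp in T.
      replace (k (u, point y) + - (k (u, point y) - k (u, point x))) with (k (u, point x)) in T by ring. lra.
  - intros m x [Hx Hb]. split; auto. intros u Hu. specialize (Hb u Hu).
    eapply Rle_trans; [exact Hb|]. rewrite S_INR. lra.
  - intros x Hx. destruct (bounded_by_exists (point x)) as [M [M0 HM]].
    { apply near_nbhd, point_near; lra. }
    destruct (INR_unbounded M) as [m Hm]. exists m. split; [lra|]. intros u Hu.
    specialize (HM u Hu). lra.
  - exists (INR m). split; [apply pos_INR|]. intros N. destruct (Hm N) as [tau [H1 H2]].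
    exists tau. split; auto. intros i Hi. destruct (H1 i Hi) as [[Ha Hb] Hc]. auto.
Qed.

Definition well_spaced (t : nat -> C) (N : nat) : Prop :=
  (forall j, (j <= N)%nat -> (Cmod (t j - z0) <= eta)%R) /\
  (forall i j, (i < j <= N)%nat -> (eta / (2 * INR (S N)) * INR (j - i) <= Cmod (t j - t i))%R).

Lemma INR_S_pos n : (0 < INR (S n))%R.
Proof. apply lt_0_INR. lia. Qed.

Lemma well_spaced_step_pos N : (0 < eta / (2 * INR (S N)))%R.
Proof. assert (H := eta_pos). assert (H' := INR_S_pos N). apply Rdiv_lt_0_compat; lra. Qed.

Lemma well_spaced_dist t N y : well_spaced t N -> (Cmod (y - z0) <= eta)%R ->
  forall j, (j <= N)%nat -> (Cmod (y - t j) <= 2 * eta)%R.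
Proof.
  intros [Ht _] Hy j Hj. specialize (Ht j Hj).
  assert (T := Cmod_triangle (y - z0) (- (t j - z0))). rewrite Cmod_opp in T.
  replace (y - z0 + - (t j - z0)) with (y - t j) in T by ring. lra.
Qed.

(** Spacing [eta / (2 (N + 1))] and distances at most [2 eta] give the exponential of
    [2 * (2 eta) * 2 (N + 1) / eta = 8 (N + 1)]. *)
Lemma interpolation_l1_norm t N y : well_spaced t N -> (Cmod (y - z0) <= eta)%R ->
  (l1_norm (newton t N y) <= exp 8 ^ S N)%R.
Proof.
  intros Ht Hy. assert (E0 := eta_pos). assert (S0 := INR_S_pos N).
  rewrite <- exp_mult_INR.
  replace (8 * INR (S N))%R with (2 * (2 * eta) / (eta / (2 * INR (S N))))%R by (field; lra).
  apply (newton_l1_norm_exp t _ N).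
  - apply well_spaced_step_pos.
  - lra.
  - apply Ht.
  - apply well_spaced_dist; assumption.
  - lia.
Qed.

Lemma interpolation_error t N y v M : well_spaced t N -> (Cmod (y - z0) <= eta)%R ->
  nbhd v -> (0 <= M)%R -> bounded_by M v ->
  (Cmod (k (y, v) - eval (newton t N y) (fun u => k (u, v))) <= 8 * delta / gap * M * ratio ^ N)%R.
Proof.
  intros Ht Hy Hv HM Hb. destruct rect_ne as [Hx Hy'].
  assert (E0 := eta_pos). assert (r0 := gap_pos).
  assert (H := newton_error x1 x2 y1 y2 (fun u => k (u, v)) t N y M gap (2 * eta) Hx Hy').
  set (W := Cmod _) in H. assert (W0 : (0 <= W)%R) by apply Cmod_ge_0.
  assert (PI1 : (1 <= 2 * PI)%R) by (assert (Q := PI2_1); unfold Rdiv in Q; lra).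
  apply Rle_trans with (2 * PI * W)%R; [fold W; nra|].
  eapply Rle_trans; [apply H; clear H|].
  - intros z Hz. apply Hdiff; auto. apply rect_nbhd; auto.
  - intros j Hj. apply near_open_rect, Ht, Hj.
  - intros i j Hij E. destruct Ht as [_ Ht]. specialize (Ht i j Hij).
    rewrite E in Ht. replace (t i - t i) with (RtoC 0) in Ht by ring. rewrite Cmod_0 in Ht.
    assert (P := well_spaced_step_pos N).
    assert (0 < INR (j - i))%R by (apply lt_0_INR; lia).
    assert (0 < eta / (2 * INR (S N)) * INR (j - i))%R by (apply Rmult_lt_0_compat; auto). lra.
  - apply near_open_rect; auto.
  - auto.
  - auto.
  - lra.
  - exact Hb.
  - intros z Hz. apply boundary_far; auto.
  - intros z j Hz Hj. apply boundary_far; auto. apply Ht; auto.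
  - apply well_spaced_dist; auto.
  - right. unfold x1, x2, y1, y2, ratio. field. lra.
Qed.

(** The increments of the interpolants and their distance to the section are both
    estimated by [kernel_node_control]. The increments involve only nodes, where the
    bound [M] is uniform, so their decay is uniform in [y]; the distance to the section
    also involves the point [y] itself, so that its rate depends on [y]. *)
Theorem local_holomorphy w : Omega w -> exists l, has_cderiv (fun y => k (y, w)) z0 l.
Proof.
  intros Hw. destruct nodes_exist as (M & M0 & Hnodes).
  set (tau := fun N => proj1_sig (constructive_indefinite_description _ (Hnodes N))).
  assert (Htau : forall N,
    (forall i, (i <= N)%nat -> bounded_by M (point (tau N i)) /\ (0 <= tau N i <= 1)%R) /\
    (forall i, (i < N)%nat -> (tau N i + / (2 * INR (S N)) <= tau N (S i))%R)).
  { intros N. unfold tau. destruct constructive_indefinite_description as [x Hx]. exact Hx. }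
  clearbody tau. clear Hnodes.
  set (t := fun N j => point (tau N j)).
  assert (E0 := eta_pos). assert (r0 := gap_pos). assert (q0 := ratio_pos). assert (e0 := exp8_pos).
  assert (Ht : forall N, well_spaced (t N) N).
  { intros N. destruct (Htau N) as [H1 H2]. split.
    - intros j Hj. apply point_near, H1, Hj.
    - intros i j Hij. unfold t. rewrite point_dist.
      assert (Hsum := spaced_sum (tau N) _ N H2 i j ltac:(lia)).
      apply Rle_trans with (eta * (tau N j - tau N i))%R.
      + replace (eta / (2 * INR (S N)) * INR (j - i))%R with (eta * (/ (2 * INR (S N)) * INR (j - i)))%R
          by (field; assert (P := INR_S_pos N); lra).
        apply Rmult_le_compat_l; [lra|exact Hsum].
      + apply Rmult_le_compat_l; [lra|]. apply Rle_abs. }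
  assert (Hsupp : forall N y, supported (newton (t N) N y) (fun p => nbhd p /\ bounded_by M p)).
  { intros N y. apply newton_supported. intros j Hj. destruct (Htau N) as [H1 _].
    destruct (H1 j ltac:(lia)). split; [apply near_nbhd, point_near|]; assumption. }
  set (A := fun N y => eval (newton (t N) N y) (fun u => k (u, w))).
  set (c0 := (8 * delta / gap)%R). assert (c00 : (0 <= c0)%R).
  { unfold c0. apply Rdiv_le_0_compat; auto. unfold delta. lra. }
  set (kw := (Cmod (k (w, w)) + 1)%R). assert (kw0 : (0 <= kw)%R).
  { assert (P := Cmod_ge_0 (k (w, w))). unfold kw. lra. }
  assert (qe : forall n, (exp 8 ^ n * ratio ^ n = (1 / 4) ^ n)%R).
  { intros n. rewrite <- Rpow_mult_distr, ratio_eq. reflexivity. }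
  assert (q1 : (ratio <= 1)%R).
  { assert (Q := ratio_eq). assert (1 <= exp 8)%R by (assert (X := exp_ineq1_le 8); lra). nra. }
  assert (pe : forall n, (1 <= exp 8 ^ n)%R).
  { intros n. apply pow_R1_Rle. assert (X := exp_ineq1_le 8). lra. }
  assert (pq : forall n, (0 <= ratio ^ n)%R) by (intros n; apply pow_le; lra).
  set (K := (kw * (2 * exp 8 ^ 2 * (2 * c0 * M)))%R).
  assert (K0 : (0 <= K)%R).
  { unfold K. apply Rmult_le_pos; auto. apply Rmult_le_pos.
    - apply Rmult_le_pos; [lra|apply pow_le; lra].
    - apply Rmult_le_pos; auto. lra. }
  (* Both interpolation errors at a node are at most [c0 * M * ratio ^ n]; the
     coefficients contribute [exp 8 ^ (n + 2)]. *)
  assert (Hinc : forall y, (Cmod (y - z0) <= eta)%R -> forall n,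
    (Cmod (A (S n) y - A n y) <= sqrt K * (1 / 2) ^ n)%R).
  { intros y Hy n. apply le_of_sq_le_geometric; auto.
    set (l := newton (t (S n)) (S n) y ++ scale (- (1)) (newton (t n) n y)).
    assert (El : forall f, eval l f = eval (newton (t (S n)) (S n) y) f - eval (newton (t n) n y) f).
    { intros f. unfold l. rewrite eval_app, eval_scale. ring. }
    assert (Sl : supported l (fun p => nbhd p /\ bounded_by M p)).
    { apply supported_app; [|apply supported_scale]; apply Hsupp. }
    assert (HQ := kernel_node_control Omega k l w (2 * c0 * M * ratio ^ n) Hk).
    rewrite El in HQ. fold (A (S n) y) (A n y) in HQ.
    eapply Rle_trans; [apply HQ; clear HQ; auto|].
    - eapply supported_incl; [|exact Sl]. intros p [Hp _]. auto.
    - eapply supported_incl; [|exact Sl]. intros p [Hp Hpb]. rewrite El.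
      assert (e1 := interpolation_error (t (S n)) (S n) y p M (Ht _) Hy Hp M0 Hpb).
      assert (e2 := interpolation_error (t n) n y p M (Ht _) Hy Hp M0 Hpb).
      set (u1 := eval (newton (t (S n)) (S n) y) _) in *. set (u2 := eval (newton (t n) n y) _) in *.
      fold c0 in e1, e2.
      assert (T := Cmod_triangle (k (y, p) - u2) (- (k (y, p) - u1))). rewrite Cmod_opp in T.
      replace (k (y, p) - u2 + - (k (y, p) - u1)) with (u1 - u2) in T by ring.
      assert (c0 * M * ratio ^ S n <= c0 * M * ratio ^ n)%R.
      { apply Rmult_le_compat_l; [apply Rmult_le_pos; auto|]. simpl. specialize (pq n). nra. }
      lra.
    - fold kw. unfold K. rewrite <- qe, (Rmult_assoc kw). apply Rmult_le_compat_l; auto.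
      apply Rle_trans with ((2 * exp 8 ^ S (S n)) * (2 * c0 * M * ratio ^ n))%R.
      + apply Rmult_le_compat_r. { apply Rmult_le_pos; [apply Rmult_le_pos; [lra|exact M0]|apply pq]. }
        unfold l. rewrite l1_norm_app, l1_norm_scale, Cmod_opp, Cmod_1, Rmult_1_l.
        assert (B1 := interpolation_l1_norm (t (S n)) (S n) y (Ht _) Hy).
        assert (B2 := interpolation_l1_norm (t n) n y (Ht _) Hy).
        assert (exp 8 ^ S n <= exp 8 ^ S (S n))%R.
        { apply Rle_pow; [|lia]. assert (X := exp_ineq1_le 8). lra. }
        lra.
      + right. simpl. ring. }
  (* The point [y] is adjoined to the nodes with coefficient 1, so the bound on the
     contour has to cover the section at [y] as well. *)
  assert (Hlim : forall y, (Cmod (y - z0) <= eta)%R -> exists K', (0 <= K')%R /\ forall n,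
    (Cmod (k (y, w) - A n y) <= K' * (1 / 2) ^ n)%R).
  { intros y Hy. destruct (bounded_by_exists y (near_nbhd y Hy)) as (My & My0 & HMy).
    set (M' := Rmax M My). assert (M'0 : (0 <= M')%R) by (eapply Rle_trans; [exact M0|apply Rmax_l]).
    set (G := (kw * (2 * exp 8 * (c0 * M')))%R).
    assert (G0 : (0 <= G)%R).
    { unfold G. apply Rmult_le_pos; auto. apply Rmult_le_pos; [lra|]. apply Rmult_le_pos; auto. }
    exists (sqrt G). split; [apply sqrt_pos|]. intros n. apply le_of_sq_le_geometric; auto.
    set (l := (RtoC 1, y) :: scale (- (1)) (newton (t n) n y)).
    assert (El : forall f, eval l f = f y - eval (newton (t n) n y) f).
    { intros f. unfold l. cbn [eval]. rewrite eval_scale. ring. }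
    assert (Sl : supported l (fun p => nbhd p /\ bounded_by M' p)).
    { intros c p [E|I].
      - injection E as <- <-. split; [apply near_nbhd; auto|]. intros u Hu.
        eapply Rle_trans; [exact (HMy u Hu)|apply Rmax_r].
      - refine (supported_scale (- (1)) _ (fun p => nbhd p /\ bounded_by M' p) _ c p I). eapply supported_incl; [|apply Hsupp].
        intros p' [Hp Hpb]. split; auto. intros u Hu.
        eapply Rle_trans; [exact (Hpb u Hu)|apply Rmax_l]. }
    assert (HQ := kernel_node_control Omega k l w (c0 * M' * ratio ^ n) Hk).
    rewrite El in HQ. fold (A n y) in HQ.
    eapply Rle_trans; [apply HQ; clear HQ; auto|].
    - eapply supported_incl; [|exact Sl]. intros p [Hp _]. auto.
    - eapply supported_incl; [|exact Sl]. intros p [Hp Hpb]. rewrite El.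
      apply (interpolation_error (t n) n y p M' (Ht _) Hy Hp M'0 Hpb).
    - fold kw. unfold G. rewrite <- qe, (Rmult_assoc kw). apply Rmult_le_compat_l; auto.
      apply Rle_trans with ((2 * exp 8 ^ S n) * (c0 * M' * ratio ^ n))%R.
      + apply Rmult_le_compat_r. { apply Rmult_le_pos; [apply Rmult_le_pos; assumption|apply pq]. }
        unfold l. cbn [l1_norm]. rewrite l1_norm_scale, Cmod_opp, Cmod_1, Rmult_1_l.
        assert (B2 := interpolation_l1_norm (t n) n y (Ht _) Hy).
        specialize (pe (S n)). lra.
      + right. simpl. ring. }
  apply (Weierstrass A (fun y => k (y, w)) z0 eta (fun n => 2 * sqrt K * (1 / 2) ^ n)%R E0).
  - intros n z _. apply newton_has_cderiv.
  - intros n y Hy. apply Rlt_le in Hy. destruct (Hlim y Hy) as (K' & K'0 & HK').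
    apply (geometric_tail (fun n => A n y) (k (y, w)) (sqrt K) K'); auto. apply sqrt_pos.
  - intros e He. assert (SK := sqrt_pos K).
    destruct (pow_lt_1_zero (1 / 2) ltac:(rewrite Rabs_pos_eq; lra) (e / (2 * sqrt K + 1)) ltac:(apply Rdiv_lt_0_compat; lra)) as [n Hn].
    specialize (Hn n (Nat.le_refl n)). rewrite Rabs_pos_eq in Hn by (apply pow_le; lra).
    exists n. assert (P : (0 <= (1 / 2) ^ n)%R) by (apply pow_le; lra).
    apply (Rmult_lt_compat_l (2 * sqrt K + 1)) in Hn; [|lra].
    replace ((2 * sqrt K + 1) * (e / (2 * sqrt K + 1)))%R with e in Hn by (field; lra). lra.
Qed.

End Local.

(** Near the diagonal point [(z, z)] the open set [U] contains a product of two equal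
    squares, which is the setting of [local_holomorphy]. *)
Lemma section_holomorphic Omega k U z w :
  positive_definite_kernel Omega k -> open U ->
  (forall p : C * C, U p -> square Omega p) -> (forall x : C, Omega x -> U (x, x)) ->
  sesquiholomorphic_on U k -> Omega z -> Omega w ->
  exists l, has_cderiv (fun y => k (y, w)) z l.
Proof.
  intros Hk HU Hsub Hdiag [g [[Hg _] Hkg]] Hz Hw.
  destruct (HU (z, z) (Hdiag z Hz)) as [d Hd].
  set (D := open_rect (Re z - d) (Re z + d) (Im z - d) (Im z + d)).
  assert (HDU : forall u v, D u -> D v -> U (u, v)).
  { intros u v [Hu1 Hu2] [Hv1 Hv2]. apply Hd.
    split; split; apply Rabs_def1; unfold minus, plus, opp, Re, Im in *; simpl in *; lra. }
  apply (local_holomorphy Omega k Hk z d (cond_pos d)); auto.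
  - intros v Hv. exact (proj1 (Hsub _ (HDU v v Hv Hv))).
  - intros u v Hu Hv.
    destruct (proj1 (ex_derive_has_cderiv _ _) (Hg (Cconj v) u ltac:(unfold conj_snd; simpl; rewrite Cconj_conj; auto))) as [l Hl].
    destruct (open_rect_gap _ _ _ _ _ Hu) as (r & r0 & _ & Hr).
    exists l. refine (has_cderiv_ext_loc _ _ _ _ r r0 _ Hl).
    intros y Hy. symmetry. apply Hkg, HDU; auto. apply Hr, Hy.
Qed.

(** * Extension to the whole square *)

Theorem theorem3p13
    (Omega : C -> Prop) (k : C * C -> C) (U : C * C -> Prop)
    (HOmega : open Omega)
    (Hk : positive_definite_kernel Omega k)
    (HU : open U)
    (HUsub : forall p : C * C, U p -> square Omega p)
    (HUdiag : forall x : C, Omega x -> U (x, x))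
    (Hsesq : sesquiholomorphic_on U k) :
  holomorphic_positive_definite_kernel Omega k.
Proof.
  assert (Hsec := fun z w => section_holomorphic Omega k U z w Hk HU HUsub HUdiag Hsesq).
  split; [exact HOmega|split; [exact Hk|]].
  exists (fun p => k (fst p, Cconj (snd p))). split; [split|].
  - intros y x [Hx Hy]. apply ex_derive_has_cderiv. exact (Hsec x (Cconj y) Hx Hy).
  - intros x y [Hx Hy]. simpl in Hx, Hy. apply ex_derive_has_cderiv.
    destruct (Hsec (Cconj y) x Hy Hx) as [l Hl]. apply has_cderiv_conj in Hl.
    destruct (HOmega (Cconj y) Hy) as [d Hd].
    exists (Cconj l). refine (has_cderiv_ext_loc _ _ _ _ d (cond_pos d) _ Hl).
    intros v Hv. simpl. symmetry. apply (kernel_hermitian Omega); auto.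
    apply Hd. apply C_NormedModule_mixin_compat1.
    change (minus (Cconj v) (Cconj y)) with (Cconj v - Cconj y).
    rewrite <- Cminus_conj, Cmod_conj. exact Hv.
  - intros u v _. simpl. rewrite Cconj_conj. reflexivity.
Qed.
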